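(* Let $\{X_t\}$ be an irreducible Markov chain on a finite state space $\Sigma$, let $i\in\Sigma$, $\epsilon,\alpha,\delta\in(0,1)$, and run $\mathrm{IteratedRefinement}(i,\epsilon,\alpha)$. With probability greater than $1-\alpha$, for all $k$ such that $\hat p^{(k)}<\delta$, $$\left|\frac{\hat\pi_i^{(k)}-\pi_i}{\hat\pi_i^{(k)}}\right|\le\epsilon\left(1+\tfrac{2}{3}Z_{\max}(i)\right)+2\delta Z_{\max}(i)\le\epsilon+4\ln(2)\,t_{\mathrm{mix}}\left(\delta+\tfrac{\epsilon}{3}\right).$$ With probability greater than $1-\alpha$, the number of random walk steps used by the algorithm before satisfying $\hat p^{(k)}<\delta$ is bounded above by $$\tilde O\left(\frac{H_i\ln(1/\alpha)\ln(1/\delta)}{\epsilon^2}\right)=\tilde O\left(\frac{t_{\mathrm{mix}}\ln(1/\alpha)\ln(1/\delta)}{\pi_i\epsilon^2}\right).$$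
   Context: Chain: $\{X_t\}_{t\ge0}$ is a discrete-time Markov chain with transition matrix $P$ and unique stationary distribution $\pi$; $\mathbb P_i(\cdot)=\mathbb P(\cdot\mid X_0=i)$, $\mathbb E_i[\cdot]=\mathbb E[\cdot\mid X_0=i]$; $T_i=\inf\{t\ge1:X_t=i\}$. Mixing quantities (finite $\Sigma$): $H_i=\max_{j\in\Sigma}\mathbb E_j[T_i]$; the fundamental matrix is $Z=(I-P+\mathbf 1\pi^T)^{-1}$, also written $Z=\sum_{t\ge0}(P^t-\mathbf 1\pi^T)$; $Z_{\max}(i)=\max_{k\in\Sigma}|Z_{ki}|$; $t_{\mathrm{mix}}=\min\{t:\max_{x\in\Sigma}\|P^t(x,\cdot)-\pi\|_{TV}\le1/4\}$ with $\|\cdot\|_{TV}$ total variation distance. Algorithm $\mathrm{IteratedRefinement}(i,\epsilon,\alpha)$: iterations $k=1,2,\dots$ with truncation thresholds $\theta^{(k)}=2^k$ and sample sizes $N^{(1)}=\lceil 6(1+\epsilon)\ln(8/\alpha)/\epsilon^2\rceil$, $N^{(k+1)}=\lceil 3(1+\epsilon)\theta^{(k+1)}\ln(4\theta^{(k+1)}/\alpha)/(\hat T_i^{(k)}\epsilon^2)\rceil$. In iteration $k$, $N^{(k)}$ fresh independent realizations of the chain started at $X_0=i$ are simulated, each stopped at the first time $t\ge1$ with $t=\theta^{(k)}$ or $X_t=i$; the $s$-th has length $t_s$ distributed as $\min(T_i,\theta^{(k)})$. Set $\hat T_i^{(k)}=\frac1{N^{(k)}}\sum_{s=1}^{N^{(k)}}t_s$,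 $\hat\pi_i^{(k)}=1/\hat T_i^{(k)}$, and let $\hat p^{(k)}$ be the fraction of the $N^{(k)}$ samples that are truncated (those with $T_i>\theta^{(k)}$). The number of random walk steps in iteration $k$ is $N^{(k)}\hat T_i^{(k)}$. Notation: $\tilde O(f(a)g(b))=O(f(a)\,\mathrm{polylog} f(a))\,O(g(b)\,\mathrm{polylog} g(b))$; when two $\tilde O$-expressions are joined by ''$=$'', the right one is a further upper bound for the left one.
   Formalization: Step bound: constants depend on A, uniform where α,δ ≤ 1−1/A and (δ^A ≤ α or ε² ≤ Aδ), as the uniform claim is false. The bound by t_mix uses Z as the (Cesàro) series, as it fails for the inverse; t_mix is taken over t ≥ 1. *)

(* Defs.v *)
From HB Require Import structures.
From mathcomp Require Import all_boot all_order all_algebra.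
From mathcomp Require Import all_classical all_reals all_analysis.
Import Order.TTheory GRing.Theory Num.Theory.
Import numFieldNormedType.Exports.

Set Implicit Arguments.
Unset Strict Implicit.
Unset Printing Implicit Defensive.

Local Open Scope classical_set_scope.
Local Open Scope ring_scope.

Section FiniteChain.
Context {R : realType} {n : nat}.
Implicit Types (P Z : 'M[R]_n) (mu nu pi : 'rV[R]_n) (i j : 'I_n).

Definition stochastic P :=
  (forall x y, 0 <= P x y) /\ (forall x, \sum_y P x y = 1).

Definition irreducible P := forall x y, exists t : nat, 0 < (P ^+ t) x y.

Definition stationary P pi :=
  [/\ forall x, 0 <= pi 0 x, \sum_x pi 0 x = 1 & pi *m P = pi].

Definition TV mu nu : R :=
  \big[Num.max/0]_(A : {set 'I_n})
    `| \sum_(x in A) mu 0 x - \sum_(x in A) nu 0 x |.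

(* +oo when no such t exists, which is the case exactly for periodic chains.
   Starting at t = 1 only matters for the one-point chain, whose mixing time
   would otherwise be 0. *)
Definition tmix P pi : \bar R :=
  ereal_inf [set t%:R%:E | t in [set t : nat | (0 < t)%N /\
    \big[Num.max/0]_(x < n) TV (row x (P ^+ t)) pi <= 4^-1]].

(* (I - P + 1 pi^T)^-1 *)
Definition fundamental_inv P pi : 'M[R]_n :=
  invmx (1%:M - P + const_mx 1 *m pi).

(* The series sum_(t >= 0) (P^t - 1 pi^T), summed in the sense of Cesaro: this
   is its ordinary sum when P is aperiodic, and still makes sense when P is
   periodic.  It equals (I - P + 1 pi^T)^-1 - 1 pi^T, hence differs from
   fundamental_inv: the terms of the Neumann series of fundamental_inv are
   (P - 1 pi^T)^t, which is P^t - 1 pi^T for t > 0, but I for t = 0. *)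
Definition fundamental_series P pi : 'M[R]_n :=
  \matrix_(k, j)
    limn (arithmetic_mean (series (fun t : nat => (P ^+ t) k j - pi 0 j))).

Definition Zmax Z i : R := \big[Num.max/0]_(k < n) `|Z k i|.

End FiniteChain.

Section Independence.
Context {R : realType} {d : measure_display} {Omega : measurableType d}.
Variable Pr : probability Omega R.

Definition mutually_independent (I : eqType) (F : I -> set (set Omega)) :=
  forall (J : seq I) (A : I -> set Omega), uniq J ->
    (forall j, j \in J -> F j (A j)) ->
    Pr (\big[setI/setT]_(j <- J) A j) = (\prod_(j <- J) Pr (A j))%E.

Definition sigma_process {S : Type} (X : nat -> Omega -> S) : set (set Omega) :=
  <<s [set A | exists t x, A = X t @^-1` [set x]] >>.

(* The last clause is P(X_{t+1} = x_{t+1} | X_0 = x_0, ..., X_t = x_t)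
   = P x_t x_{t+1}, multiplied out. *)
Definition markov_chain_from {n : nat} (P : 'M[R]_n) (i : 'I_n)
    (X : nat -> Omega -> 'I_n) :=
  [/\ forall t x, measurable (X t @^-1` [set x]),
      Pr (X 0%N @^-1` [set i]) = 1%E &
      forall (t : nat) (x : nat -> 'I_n),
        Pr [set w | forall s, (s <= t.+1)%N -> X s w = x s] =
        (Pr [set w | forall s, (s <= t)%N -> X s w = x s]
          * (P (x t) (x t.+1))%:E)%E].

End Independence.

(* inf {t >= 1 : x_t = i}, +oo when x never returns to i *)
Definition return_time {R : realType} {S : Type} (i : S) (x : nat -> S)
    : \bar R :=
  ereal_inf [set t%:R%:E | t in [set t : nat | (0 < t)%N /\ x t = i]].

(* H_i = max_j E_j[T_i], where under Q j the process Y is the chain started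
   at j. *)
Definition max_hitting_time {R : realType} {n : nat} {d : measure_display}
    {Omega : measurableType d} (Q : 'I_n -> probability Omega R)
    (Y : nat -> Omega -> 'I_n) (i : 'I_n) : \bar R :=
  \big[maxe/-oo%E]_(j < n) (\int[Q j]_w return_time i (Y^~ w))%E.

(* One run of IteratedRefinement(i, eps, alpha) on given trajectories.
   Iterations are numbered from 0, so that all indices are shifted by one with
   respect to the usual presentation: iteration k has threshold 2^(k+1), and
   x k s is the trajectory from which its s-th sample is read. *)
Section IteratedRefinement.
Context {R : realType} {S : Type}.
Variables (i : S) (eps alpha : R) (x : nat -> nat -> nat -> S).

Definition theta (k : nat) : nat := (2 ^ k.+1)%N.

Definition sample_length (k s : nat) : R :=
  fine (mine (return_time i (x k s)) (theta k)%:R%:E).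

Definition sample_truncated (k s : nat) : bool :=
  ((theta k)%:R%:E < return_time i (x k s) :> \bar R)%E.

Definition mean_length (k N : nat) : R :=
  N%:R^-1 * \sum_(s < N) sample_length k s.

Fixpoint sample_size (k : nat) : nat :=
  match k with
  | 0 => `|Num.ceil (6 * (1 + eps) * ln (8 / alpha) / eps ^+ 2)|%N
  | k'.+1 =>
      `|Num.ceil (3 * (1 + eps) * (theta k)%:R * ln (4 * (theta k)%:R / alpha)
                  / (mean_length k' (sample_size k') * eps ^+ 2))|%N
  end.

Definition That (k : nat) : R := mean_length k (sample_size k).

Definition pihat (k : nat) : R := (That k)^-1.

Definition phat (k : nat) : R :=
  (sample_size k)%:R^-1 * \sum_(s < sample_size k) (sample_truncated k s)%:R.

(* Steps of all iterations up to and including the first k with phat k < delta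
   (+oo if there is none): iteration k counts when no earlier one has
   satisfied the criterion. *)
Definition total_steps (delta : R) : \bar R :=
  (\sum_(0 <= k <oo | all (fun j => (delta <= phat j)%R) (iota 0 k))
     ((sample_size k)%:R * That k)%:E)%E.

End IteratedRefinement.

(* A representative of O(f polylog f), that is f times a power of log f; the
   logarithm is made at least 1 so that only large values of f matter. *)
Definition softO {R : realType} (m : nat) (f : \bar R) : \bar R :=
  (f * (1 + lne (1 + f)) ^+ m)%E.

(* Sets of parameters on which the constants of the soft-O bounds are uniform;
   every (eps, alpha, delta) in (0,1)^3 belongs to regime A for all large A.
   The first two clauses keep ln(1/alpha) and ln(1/delta) away from 0: a bound
   proportional to them fails there, as at least one step is always made.  The
   third one cannot be dropped either: for a fixed chain with unbounded return
   time, eps = 1/2, alpha = exp(- delta^(-1/2)) and delta -> 0, fewer than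
   1/delta samples are drawn in each iteration with threshold at most
   ln(1/delta)^c, so that a single truncated sample there gives
   delta <= phat; and all these iterations contain one with probability
   exp(- O(ln(1/delta)^c)), which exceeds alpha. *)
Definition regime {R : realType} (A : nat) (eps alpha delta : R) :=
  [/\ alpha <= 1 - A%:R^-1, delta <= 1 - A%:R^-1 &
      delta ^+ A <= alpha \/ eps ^+ 2 <= A%:R * delta].

(* Main.v *)
Require Import Defs.
From HB Require Import structures.
From mathcomp Require Import all_boot all_order all_algebra.
From mathcomp Require Import all_classical all_reals all_analysis.
From mathcomp Require Import measurable_realfun ring lra zify.
Import Order.TTheory GRing.Theory Num.Theory.
Import numFieldNormedType.Exports.
Local Open Scope classical_set_scope.
Local Open Scope ring_scope.

Set Implicit Arguments.
Unset Strict Implicit.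
Unset Printing Implicit Defensive.

(* Exact identities replace hitting-time estimates: if z is column i of the
   fundamental matrix, then w(j) = z(i) - z(j) + [j = i] is pi_i E_j[T_i], and
   killing the chain at i gives
     pi_i E_i[min(T_i, t)] = 1 - E_i[w(X_t); T_i > t],
   which bounds the truncation bias by 2 Zmax(i) P_i(T_i > t).

   Zmax(i) <= (11/8) t_mix: with T = t_mix, write z = S + P^T z where S sums the
   first T terms of the series, and iterate once more; P^T halves oscillations,
   so the remaining geometric tail is at most half of the oscillation of P^T S,
   whose T terms all lie within 1/4 of 0.  Note that 11/8 <= 2 ln 2, while
   geometric decay alone would only give the constant 3/2.

   Given the sample size, which is independent of the new samples, the event
   that an iteration is inaccurate although its predecessor was accurate has
   probability O(alpha / theta) by Chernoff bounds, and these are summable.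

   For the number of steps, T_i has a geometric tail with scale 2 H_i.  At a
   threshold of order H_i ln(1/delta), the truncation probability is at most
   alpha delta / 8 if alpha >= delta^A, and then a single truncated sample is
   already unlikely; if eps^2 <= A delta, it is at most delta / 8 and there are
   enough samples for p-hat to concentrate. *)

(** * Exponential inequalities *)

(** The sample size of an iteration is random and depends on all earlier samples. Every random
    quantity is therefore expressed through the discrete values min(T_i, theta + 1), so that
    conditioning amounts to summing over countably many atoms. With L the logarithm in the sample
    size, exp(- L) = alpha / (4 theta) is the probability allotted to each bad event of an
    iteration. The numbers 1 / theta add up to 1, so a family of bad events costs alpha / 4. The
    error bound spends three families; the step count spends two and leaves less than alpha / 2 for
    the stopping event. This is why both probabilities exceed 1 - alpha strictly. Write mu =
    E_i[min(T_i, theta)]. The upper half That <= (1 + eps) mu of the accuracy keeps the recursion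
    going: the next sample size divides by That, and its factor 1 + eps absorbs the overestimate.
    Both versions of the fundamental matrix satisfy the same Poisson equation, through which alone
    the error bound sees them. For periodic chains, where t_mix is infinite, identities for finite
    sums take the place of convergence of P^t. *)

Section Exponential.
Context {R : realType}.
Implicit Types x y l : R.

Lemma ge0_derive_homo (f g : R -> R) x :
  (forall y, is_derive y 1 f (g y)) -> (forall y, 0 <= y -> 0 <= g y) ->
  0 <= x -> f 0 <= f x.
Proof.
move=> df g0 x0; apply: (@ger0_derive1_le_cc _ f 0 x) => //.
- by move=> y; rewrite in_itv/= => /andP[/ltW y0 _]; rewrite derive1E derive_val g0.
- apply: continuous_subspaceT => y.
  by apply: differentiable_continuous; apply/derivable1_diffP; case: (df y).
- by rewrite in_itv/= lexx.
- by rewrite in_itv/= lexx x0.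
Qed.

(** The Padé approximant (2 + x) / (2 - x) dominates exp on [0, 2), and the left side is nonpositive
    beyond. The derivative of the difference, 1 - (1 - y) exp y, is nonnegative because exp (- y) >=
    1 - y. *)
Lemma expR_le_pade x : 0 <= x -> (2 - x) * expR x <= 2 + x.
Proof.
move=> x0.
have := @ge0_derive_homo
  ((cst 2 + id) - (cst 2 - id) * expR) (fun y => 1 - (1 - y) * expR y) x.
rewrite !fctE/= expR0 => h; suff: 2 + 0 - (2 - 0) * 1 <= 2 + x - (2 - x) * expR x by lra.
apply: h => // y.
  by apply: is_derive_eq; rewrite /GRing.scale/=; ring.
move=> y0; have := expR_ge1Dx (- y); rewrite expRN.
have e0 := expR_gt0 y.
by rewrite -(ler_pM2r e0) mulVf ?gt_eqF//; lra.
Qed.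

Lemma expR_ge1Dx2 x : 0 <= x -> 1 + x + x ^+ 2 / 2 <= expR x.
Proof.
move=> x0.
have := @ge0_derive_homo (expR - (cst 1 + id + 2^-1 *: (id ^+ 2)))
  (fun y => expR y - (1 + y)) x.
rewrite !fctE/= expR0 /GRing.scale/= => h.
suff: 1 - (1 + 0 + 2^-1 * 0 ^+ 2) <= expR x - (1 + x + 2^-1 * x ^+ 2) by lra.
apply: h => // y; last by have := expR_ge1Dx y; lra.
by apply: is_derive_eq; rewrite /GRing.scale/=; field.
Qed.

(** Inverts [expR_ge1Dx2], using (1 - x + x^2/2)(1 + x + x^2/2) = 1 + x^4/4 >= 1. *)
Lemma expRN_le x : 0 <= x -> expR (- x) <= 1 - x + x ^+ 2 / 2.
Proof.
move=> x0; rewrite expRN; have e := expR_ge1Dx2 x0.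
have p : 0 < 1 + x + x ^+ 2 / 2 by have := sqr_ge0 x; lra.
apply: (@le_trans _ _ (1 + x + x ^+ 2 / 2)^-1).
  by rewrite lef_pV2 ?posrE ?expR_gt0.
rewrite -(ler_pM2r p) mulVf ?gt_eqF//; have := sqr_ge0 (x ^+ 2).
rewrite -(@ler_pM2r _ (4^-1 : R))// => h.
suff : (1 - x + x ^+ 2 / 2) * (1 + x + x ^+ 2 / 2) = 1 + x ^+ 2 ^+ 2 / 4 by lra.
by field.
Qed.

(** The coefficient approaches the Taylor value 1/2 as l tends to 0. This precision is spent in
    [truncated_additive_tail], where a coefficient 1 would give too small a rate for small eps. *)
Lemma expR_le_quadratic l y : l <= 1 -> `|y| <= l ->
  expR y <= 1 + y + (1 + l) / 2 * y ^+ 2.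
Proof.
move=> l1 yl; have y2 := sqr_ge0 y; have [y0|y0] := leP 0 y.
  rewrite ger0_norm// in yl; have e := expR_le_pade y0.
  have p : 0 < 2 - y by lra.
  rewrite -(ler_pM2l p) (le_trans e)//.
  have : 0 <= y * (1 - y) * y ^+ 2 by rewrite !mulr_ge0 ?sqr_ge0//; lra.
  have : 0 <= (l - y) * (2 - y) * y ^+ 2 by rewrite !mulr_ge0 ?sqr_ge0//; lra.
  lra.
rewrite ltr0_norm// in yl.
have := @expRN_le (- y); rewrite opprK sqrrN => /(_ ltac:(lra)) e.
have : 0 <= l * y ^+ 2 by rewrite mulr_ge0//; lra.
lra.
Qed.

(** Half of the constant in Zmax(i) <= (11/8) t_mix. The Padé bound at 11/16 itself exceeds 2, so it
    is applied to a quarter of the exponent and raised to the fourth power. *)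
Lemma ln2_ge : 11 / 16 <= ln (2 : R).
Proof.
rewrite -ler_expR lnK ?posrE//.
have -> : 11 / 16 = 11 / 64 * 4%:R :> R by field.
rewrite expRM_natr.
have := @expR_le_pade (11 / 64) ltac:(lra) => e.
have {}e : expR (11 / 64 : R) <= 139 / 117 by lra.
apply: (@le_trans _ _ ((139 / 117) ^+ 4)); last by lra.
by rewrite lerXn2r ?nnegrE ?expR_ge0//; lra.
Qed.

End Exponential.

(** * The fundamental matrix of an irreducible chain *)

Section FiniteChainTheory.
Context {R : realType} {n : nat}.
Variables (P : 'M[R]_n) (pi : 'rV[R]_n).
Hypotheses (P_st : stochastic P) (P_irr : irreducible P)
  (P_pi : stationary P pi).
Implicit Types (x y k i j : 'I_n) (t T : nat) (u f : 'I_n -> R) (Z : 'M[R]_n).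

Lemma exprSE (A : 'M[R]_n) t x y :
  (A ^+ t.+1) x y = \sum_z A x z * (A ^+ t) z y.
Proof. by rewrite exprS -[A * _]/(A *m _) mxE. Qed.

Lemma exprSrE (A : 'M[R]_n) t x y :
  (A ^+ t.+1) x y = \sum_z (A ^+ t) x z * A z y.
Proof. by rewrite exprSr -[_ * A]/(_ *m A) mxE. Qed.

Lemma stochastic_exp t : stochastic (P ^+ t).
Proof.
case: P_st => P0 P1; elim: t => [|t [IH0 IH1]].
  rewrite expr0; split=> [x y|x]; first by rewrite mxE ler0n.
  rewrite (bigD1 x)//= mxE eqxx big1 ?addr0// => y yx.
  by rewrite mxE eq_sym (negbTE yx).
split=> [x y|x].
  by rewrite exprSE sumr_ge0// => z _; rewrite mulr_ge0.
under eq_bigr do rewrite exprSE.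
rewrite exchange_big/= -[RHS](P1 x); apply: eq_bigr => z _.
by rewrite -mulr_sumr IH1 mulr1.
Qed.

Lemma stationary_exp t x : \sum_y pi 0 y * (P ^+ t) y x = pi 0 x.
Proof.
case: P_pi => _ _ piP; rewrite -[RHS]/(pi 0 x).
have -> : pi 0 x = (pi *m P ^+ t) 0 x; last by rewrite mxE.
congr (fun_of_matrix _ _ _); elim: t => [|t IH]; first by rewrite expr0 mulmx1.
by rewrite exprS -[P * _]/(P *m _) mulmxA piP.
Qed.

Lemma stationary_gt0 i : 0 < pi 0 i.
Proof.
case: P_pi => pi0 pi1 _.
have [y yP] : exists y, 0 < pi 0 y.
  apply/existsP; rewrite -[X in is_true X]negbK negb_exists; apply/negP => /forallP h.
  have := @oner_neq0 R; rewrite -pi1 big1 ?eqxx// => y _.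
  by apply/eqP; rewrite eq_le pi0 leNgt h.
have [t tP] := P_irr y i.
rewrite -(stationary_exp t i) (bigD1 y)//= ltr_pwDl ?mulr_gt0//.
by rewrite sumr_ge0// => z _; rewrite mulr_ge0// (stochastic_exp t).1.
Qed.

(** Minimum principle: at a minimizer other than i, the inequality forces every successor to be a
    minimizer too, so minimality spreads along paths until it reaches i, which irreducibility
    guarantees. *)
Lemma superharmonic_min u i :
  (forall x, x != i -> \sum_y P x y * u y <= u x) -> forall x, u i <= u x.
Proof.
move=> uP x; case: P_st => P0 P1.
have [m _ mP] := @Order.TotalTheory.arg_minP _ _ _ x xpredT u isT.
apply: le_trans (mP x isT); rewrite leNgt; apply/negP => um.
have step z y : u z = u m -> 0 < P z y -> u y = u m.
  move=> zm zy; have zi : z != i by apply: contraTneq um => <-; rewrite zm ltxx.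
  have t0 k : true -> 0 <= P z k * (u k - u m).
    by move=> _; rewrite mulr_ge0// subr_ge0 mP.
  have : \sum_k P z k * (u k - u m) = 0.
    apply/eqP; rewrite eq_le sumr_ge0// andbT.
    under eq_bigr do rewrite mulrBr.
    by rewrite sumrB -mulr_suml P1 mul1r -zm subr_le0 uP.
  move=> /(psumr_eq0P t0)/(_ y isT)/eqP.
  by rewrite mulf_eq0 gt_eqF//= subr_eq0 => /eqP.
have reach t y : 0 < (P ^+ t) m y -> u y = u m.
  elim: t y => [|t IH] y.
    by rewrite expr0 mxE; case: eqP => [->//|_]; rewrite ltxx.
  rewrite exprSrE => /lt0r_neq0/eqP/psumr_neq0P[z _|z /=].
    by rewrite mulr_ge0// (stochastic_exp t).1.
  rewrite lt0r mulf_eq0 negb_or => /andP[/andP[tz zy] _].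
  by apply: (step z); [apply: IH|]; rewrite lt0r ?tz ?zy ?P0 ?(stochastic_exp t).1.
have [t /reach im] := P_irr m i.
by rewrite im ltxx in um.
Qed.

Lemma harmonic_cst u : (forall x, \sum_y P x y * u y = u x) ->
  forall x y, u x = u y.
Proof.
move=> uP x y; apply/eqP; rewrite eq_le.
by apply/andP; split; apply: superharmonic_min => z _; rewrite uP.
Qed.

Let M : 'M[R]_n := 1%:M - P + const_mx 1 *m pi.
Let G : 'M[R]_n := fundamental_inv P pi.
Let Pi : 'M[R]_n := const_mx 1 *m pi.

Let PiE k j : Pi k j = pi 0 j.
Proof. by rewrite !mxE big_ord1 !mxE mul1r. Qed.

Let P1 : P *m const_mx 1 = const_mx 1 :> 'cV[R]_n.
Proof.
apply/colP => x; rewrite !mxE -[RHS](P_st.2 x); apply: eq_bigr => y _.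
by rewrite mxE mulr1.
Qed.

Let pi1 : pi *m const_mx 1 = 1%:M :> 'M[R]_1.
Proof.
case: P_pi => _ h _; apply/matrixP => a b; rewrite !ord1 !mxE eqxx -[RHS]h.
by apply: eq_bigr => y _; rewrite mxE mulr1.
Qed.

Let piP : pi *m P = pi. Proof. by case: P_pi. Qed.

(** If M v = 0, multiplying by pi gives pi v = 0, hence P v = v; then v is constant by
    [harmonic_cst], and the constant is pi v = 0. *)
Let M_unit : M \in unitmx.
Proof.
rewrite -unitmx_tr -row_free_unit -kermx_eq0; apply/rowV0P => v /sub_kermxP.
move=> /(congr1 trmx); rewrite trmx_mul trmxK trmx0 => Mv.
have piv : pi *m v^T = 0.
  have := congr1 (mulmx pi) Mv.
  by rewrite mulmx0 /M mulmxA mulmxDr mulmxBr mulmx1 piP subrr add0r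
    mulmxA pi1 mul1mx.
have : P *m v^T = v^T.
  apply/esym/eqP; rewrite -subr_eq0 -[X in X - _]mul1mx -mulmxBl; apply/eqP.
  by move: Mv; rewrite /M mulmxDl -mulmxA piv mulmx0 addr0.
move=> Pv; have vc : forall x y, v^T x 0 = v^T y 0.
  apply: (@harmonic_cst (fun x => v^T x 0)) => x.
  by rewrite -[RHS]/(v^T x 0) -[in RHS]Pv mxE.
apply/rowP => x; rewrite [RHS]mxE.
have := congr1 (fun A : 'M[R]_1 => A 0 0) piv; rewrite !mxE.
under eq_bigr => y _ do rewrite (vc y x).
by rewrite -mulr_suml; case: P_pi => _ -> _; rewrite mul1r mxE.
Qed.

Let MG : M *m G = 1%:M. Proof. exact: mulmxV. Qed.
Let GM : G *m M = 1%:M. Proof. exact: mulVmx. Qed.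

Let piG : pi *m G = pi.
Proof.
have piM : pi *m M = pi.
  by rewrite mulmxDr mulmxBr mulmx1 piP subrr add0r mulmxA pi1 mul1mx.
by rewrite -[in LHS]piM -mulmxA MG mulmx1.
Qed.

Let G1 : G *m const_mx 1 = const_mx 1 :> 'cV[R]_n.
Proof.
have M1 : M *m const_mx 1 = const_mx 1 :> 'cV[R]_n.
  by rewrite mulmxDl mulmxBl mul1mx P1 subrr add0r -mulmxA pi1 mulmx1.
by rewrite -[in LHS]M1 mulmxA GM mul1mx.
Qed.

Let IPG : (1%:M - P) *m G = 1%:M - Pi.
Proof.
by rewrite -[X in _ = X - _]MG [M *m G]mulmxDl -(mulmxA _ pi G) piG addrK.
Qed.

Let GIP : G *m (1%:M - P) = 1%:M - Pi.
Proof. by rewrite -[X in _ = X - _]GM [G *m M]mulmxDr [G *m (_ *m _)]mulmxA G1 addrK. Qed.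

Let PiX t : Pi *m P ^+ t = Pi.
Proof.
elim: t => [|t IH]; first by rewrite expr0 mulmx1.
by rewrite exprSr -[_ * P]/(_ *m P) mulmxA IH /Pi -mulmxA piP.
Qed.

(** Telescoping through G (I - P) = I - Pi; being exact for every N, it covers periodic chains. *)
Let sum_exp N : \sum_(0 <= t < N) (P ^+ t - Pi) = G *m (1%:M - P ^+ N).
Proof.
elim: N => [|N IH]; first by rewrite big_nil expr0 subrr mulmx0.
rewrite big_nat_recr//= IH exprS -[P * _]/(P *m _).
have -> : P ^+ N - Pi = (1%:M - Pi) *m P ^+ N by rewrite mulmxBl mul1mx PiX.
rewrite -GIP -mulmxA -mulmxDr; congr (_ *m _).
by rewrite mulmxBl mul1mx subrKA.
Qed.

Lemma poisson_fundamental_inv k i :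
  G k i - \sum_y P k y * G y i = (k == i)%:R - pi 0 i.
Proof.
have := congr1 (fun A : 'M[R]_n => A k i) IPG.
by rewrite mulmxBl mul1mx !mxE big_ord1 !mxE mul1r.
Qed.

Lemma sum_stationary_fundamental_inv i : \sum_y pi 0 y * G y i = pi 0 i.
Proof. by rewrite -[in RHS]piG mxE. Qed.

(** The N-th partial sum is G - G P^N at (k, j). Averaging G P^t over t < N gives pi_j plus 1/N
    times an entry of G G (I - P^N), which stays bounded. *)
Lemma fundamental_seriesE k j : fundamental_series P pi k j = G k j - pi 0 j.
Proof.
rewrite mxE; apply/cvg_lim => //.
pose A N := G *m (G *m (1%:M - P ^+ N)).
have sE N : series (fun t : nat => (P ^+ t) k j - pi 0 j) N
    = G k j - (G *m P ^+ N) k j.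
  transitivity ((G *m (1%:M - P ^+ N)) k j); last by rewrite mulmxBr mulmx1 !mxE.
  rewrite -sum_exp summxE /series/=; apply: eq_bigr => t _.
  by rewrite [RHS]mxE [X in _ = _ + X]mxE PiE.
have PN N : \sum_(0 <= t < N) (G *m P ^+ t) k j = N%:R * pi 0 j + A N k j.
  rewrite /A -sum_exp mulmx_sumr !summxE.
  transitivity (\sum_(0 <= t < N) (pi 0 j + (G *m (P ^+ t - Pi)) k j)).
    apply: eq_bigr => t _; rewrite mulmxBr [G *m Pi]mulmxA G1 -/Pi.
    by rewrite [X in _ = _ + X]mxE [X in _ = _ + (_ + X)]mxE PiE addrCA subrr addr0.
  by rewrite big_split/= sumr_const_nat subn0 mulr_natl.
have amE N : arithmetic_mean (series (fun t : nat => (P ^+ t) k j - pi 0 j)) N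
    = (G k j - pi 0 j) - N.+1%:R^-1 * A N.+1 k j.
  rewrite /arithmetic_mean/= {1}/series/=.
  under eq_bigr do rewrite sE.
  rewrite sumrB sumr_const_nat subn0 PN -mulr_natl.
  by field.
rewrite (_ : arithmetic_mean _ = fun N => (G k j - pi 0 j) - N.+1%:R^-1 * A N.+1 k j); last first.
  exact/funext.
rewrite -[X in _ --> X]subr0; apply: cvgB; first exact: cvg_cst.
(* Entries of I - P^N have absolute value at most 1, so this bounds [A N k j] uniformly in N. *)
pose C := \sum_l `|(G *m G) k l|.
apply: (@squeeze_cvgr _ _ _ _ (fun N => - (C * N.+1%:R^-1)) (fun N => C * N.+1%:R^-1)).
- apply: nearW => N; rewrite -ler_norml normrM [X in X <= _]mulrC.
  rewrite [X in _ * X <= _]ger0_norm ?invr_ge0//.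
  rewrite ler_wpM2r ?invr_ge0// /A mulmxA mxE (le_trans (ler_norm_sum _ _ _))//.
  apply: ler_sum => l _; rewrite normrM ler_piMr// !mxE.
  have [P0 Ps] := stochastic_exp N.+1.
  have : (P ^+ N.+1) l j <= 1.
    by rewrite -(Ps l) (bigD1 j)//= lerDl sumr_ge0.
  have := P0 l j; case: (l == j) => /= a b; rewrite ler_norml; apply/andP; split; lra.
- rewrite -[X in _ --> X]oppr0; apply: cvgN; rewrite -(mulr0 C).
  by apply: cvgM; [exact: cvg_cst|exact: cvg_harmonic].
- rewrite -(mulr0 C).
  by apply: cvgM; [exact: cvg_cst|exact: cvg_harmonic].
Qed.

(** Column i differs from that of the inverse by the constant pi_i, which I - P annihilates. *)
Lemma poisson_fundamental_series k i :
  let Z := fundamental_series P pi in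
  Z k i - \sum_y P k y * Z y i = (k == i)%:R - pi 0 i.
Proof.
rewrite /= fundamental_seriesE -poisson_fundamental_inv.
under eq_bigr do rewrite fundamental_seriesE mulrBr.
by rewrite sumrB -mulr_suml P_st.2 mul1r; ring.
Qed.

End FiniteChainTheory.

(** * Survival probabilities, truncation bias and mixing *)

(** Transitions into i are killed but those out of i are kept: a start at i is allowed, and only
    returns count. *)
Definition taboo {R : realType} {n : nat} (P : 'M[R]_n) (i : 'I_n) : 'M[R]_n :=
  \matrix_(x, y) (P x y *+ (y != i)).

(* The probability that the chain started at j has not returned to i by
   time t. *)
Definition survival {R : realType} {n : nat} (P : 'M[R]_n) (i : 'I_n)
    (t : nat) (j : 'I_n) : R :=
  \sum_y (taboo P i ^+ t) j y.

Section Survival.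
Context {R : realType} {n : nat}.
Variables (P : 'M[R]_n) (pi : 'rV[R]_n) (i : 'I_n).
Hypotheses (P_st : stochastic P) (P_irr : irreducible P)
  (P_pi : stationary P pi).
Implicit Types (x y k j : 'I_n) (s t T : nat) (u f : 'I_n -> R) (Z : 'M[R]_n).

Lemma taboo_ge0 t x y : 0 <= (taboo P i ^+ t) x y.
Proof.
elim: t x y => [|t IH] x y; first by rewrite expr0 mxE ler0n.
by rewrite exprSE sumr_ge0// => z _; rewrite mulr_ge0// mxE mulrn_wge0// P_st.1.
Qed.

Lemma taboo_col0 t x : (0 < t)%N -> (taboo P i ^+ t) x i = 0.
Proof.
case: t => // t _; rewrite exprSrE big1// => z _.
by rewrite [taboo P i z i]mxE eqxx mulr0.
Qed.

Lemma survival_ge0 t j : 0 <= survival P i t j.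
Proof. by rewrite sumr_ge0// => y _; exact: taboo_ge0. Qed.

Lemma survival0 j : survival P i 0 j = 1.
Proof.
rewrite /survival (bigD1 j)//= expr0 mxE eqxx big1 ?addr0// => y yj.
by rewrite mxE eq_sym (negbTE yj).
Qed.

Lemma survivalD s t j :
  survival P i (s + t) j = \sum_x (taboo P i ^+ s) j x * survival P i t x.
Proof.
rewrite /survival; under eq_bigr => y _.
  rewrite exprD -[_ * _]/(_ *m _) mxE; over.
by rewrite exchange_big/=; apply: eq_bigr => x _; rewrite mulr_sumr.
Qed.

Lemma survivalD_le s t j c : (forall k, survival P i t k <= c) ->
  survival P i (s + t) j <= survival P i s j * c.
Proof.
move=> tc; rewrite survivalD mulr_suml; apply: ler_sum => x _.
by rewrite ler_wpM2l ?taboo_ge0.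
Qed.

Lemma survival_le1 t j : survival P i t j <= 1.
Proof.
elim: t j => [|t IH] j; first by rewrite survival0.
rewrite -add1n (le_trans (survivalD_le _ _ IH))// mulr1 /survival expr1.
rewrite -[leRHS](P_st.2 j); apply: ler_sum => y _.
by rewrite mxE; case: (y != i); rewrite ?mulr1n// mulr0n P_st.1.
Qed.

Lemma survival_homo s t j : (s <= t)%N -> survival P i t j <= survival P i s j.
Proof.
move=> st; rewrite -(subnKC st) -[leRHS]mulr1.
by apply: survivalD_le => k; exact: survival_le1.
Qed.

(** Markov's inequality: survival decreases in time, so t times its value at t is at most h, which
    makes it at most 1/2 when t >= 2 h. The Markov property iterates this over l blocks of length
    t. *)
Lemma survival_geometric (h : R) t l j :
  (forall k, \sum_(s < t) survival P i s k <= h) -> 2 * h <= t%:R -> (0 < t)%N ->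
  survival P i (l * t) j <= 2^-1 ^+ l.
Proof.
move=> th ht t0; elim: l j => [|l IH] j; first by rewrite mul0n survival0 expr0.
rewrite mulSn (le_trans (survivalD_le _ _ IH))// exprS ler_wpM2r ?exprn_ge0//.
have : t%:R * survival P i t j <= h.
  apply: le_trans (th j); rewrite mulr_natl -[t in _ *+ t]card_ord -sumr_const.
  by apply: ler_sum => s _; rewrite survival_homo// ltnW.
move=> h1; rewrite -(@ler_pM2l _ t%:R) ?ltr0n//; apply: le_trans h1 _; lra.
Qed.

Section PotentialKernel.
Variable Z : 'M[R]_n.
Hypothesis poisson : forall k,
  Z k i - \sum_y P k y * Z y i = (k == i)%:R - pi 0 i.

Let w j := Z i i - Z j i + (j == i)%:R.

(** Killing at i costs nothing: the term y = i of the sum of P j y (Z i i - Z y i) is zero. *)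
Let w_rec j : w j = pi 0 i + \sum_y taboo P i j y * w y.
Proof.
have -> : \sum_y taboo P i j y * w y = \sum_y P j y * (Z i i - Z y i).
  apply: eq_bigr => y _; rewrite mxE /w; case: eqP => [->|_] /=.
    by rewrite mulr0n subrr mulr0 mul0r.
  by rewrite mulr1n addr0.
under eq_bigr do rewrite mulrBr.
rewrite sumrB -mulr_suml P_st.2 mul1r /w; have := poisson j; lra.
Qed.

(** Off i the right side of the Poisson equation is - pi_i < 0, so - Z(., i) is superharmonic there
    and the minimum principle applies. *)
Lemma potential_min j : Z j i <= Z i i.
Proof.
rewrite -lerN2; apply: (superharmonic_min P_st P_irr (u := fun x => - Z x i)) j => x xi.
under eq_bigr do rewrite mulrN.
rewrite sumrN; have := poisson x; rewrite (negbTE xi).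
have := stationary_gt0 P_st P_irr P_pi i; rewrite mulr0n; lra.
Qed.

Let w_ge0 j : 0 <= w j.
Proof. by rewrite /w addr_ge0// subr_ge0 potential_min. Qed.

(** The recursion [w_rec] unrolled t times; each step contributes pi_i times a survival
    probability. *)
Let sum_survivalE t j :
  pi 0 i * \sum_(s < t) survival P i s j = w j - \sum_y (taboo P i ^+ t) j y * w y.
Proof.
elim: t => [|t IH].
  rewrite big_ord0 mulr0 (bigD1 j)//= expr0 mxE eqxx mul1r big1 ?addr0 ?subrr//.
  by move=> y yj; rewrite mxE eq_sym (negbTE yj) mul0r.
rewrite big_ord_recr mulrDr IH -addrA; congr (_ + _).
under [in RHS]eq_bigr => y _ do rewrite exprSrE mulr_suml.
rewrite exchange_big/= /survival mulr_sumr -sumrN -big_split -sumrN; apply: eq_bigr => y _.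
under eq_bigr do rewrite -mulrA.
by rewrite -mulr_sumr [in LHS]w_rec /=; ring.
Qed.

Lemma sum_survival_le t j : \sum_(s < t) survival P i s j <=
  (Z i i - Z j i + (j == i)%:R) / pi 0 i.
Proof.
rewrite ler_pdivlMr ?(stationary_gt0 P_st P_irr P_pi)// mulrC sum_survivalE.
rewrite gerBl sumr_ge0// => y _.
by rewrite mulr_ge0 ?taboo_ge0 ?w_ge0.
Qed.

Lemma truncated_bias t : (0 < t)%N ->
  0 <= 1 - pi 0 i * \sum_(s < t) survival P i s i <= 2 * Zmax Z i * survival P i t i.
Proof.
move=> t0; rewrite sum_survivalE {1 3}/w subrr eqxx add0r opprB addrCA subrr addr0.
rewrite sumr_ge0 ?andTb => [|y _]; last by rewrite mulr_ge0 ?taboo_ge0 ?w_ge0.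
rewrite /survival mulr_sumr; apply: ler_sum => y _.
(* A chain surviving to a time t > 0 is not at i, the one state where [w] carries the extra 1. *)
have [->|yi] := eqVneq y i; first by rewrite taboo_col0// mul0r mulr0.
rewrite mulrC ler_wpM2r ?taboo_ge0// /w (negbTE yi) addr0.
rewrite (le_trans (ler_norm _))// (le_trans (ler_normB _ _))//.
by rewrite mulr_natl mulr2n lerD// /Zmax (le_bigmax _ (fun k => `|Z k i|)).
Qed.

End PotentialKernel.

End Survival.

(** * Mixing time and the size of the fundamental matrix *)

Section Mixing.
Context {R : realType} {n : nat}.
Variables (P : 'M[R]_n) (pi : 'rV[R]_n) (i : 'I_n).
Hypotheses (P_st : stochastic P) (P_irr : irreducible P)
  (P_pi : stationary P pi).
Variable T : nat.
Hypotheses (T0 : (0 < T)%N)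
  (T_mix : \big[Num.max/0]_(x < n) TV (row x (P ^+ T)) pi <= 4^-1).
Implicit Types (x y k l j : 'I_n) (s t : nat) (f g : 'I_n -> R).

(** Subtracting min f leaves the difference of the means unchanged and makes f range over [0, c].
    Only the states where P^T exceeds pi then contribute positively, and their total excess is at
    most the total variation distance. *)
Lemma mixing_osc f c k : (forall x y, f x - f y <= c) ->
  `|\sum_x (P ^+ T) k x * f x - \sum_x pi 0 x * f x| <= c / 4.
Proof.
have [_ PT1] := stochastic_exp P_st T; have [_ pi1 _] := P_pi.
suff le f' : (forall x y, f' x - f' y <= c) ->
    \sum_x (P ^+ T) k x * f' x - \sum_x pi 0 x * f' x <= c / 4.
  move=> fc; rewrite ler_norml le ?andbT//.
  have /le : forall x y, - f x - - f y <= c by move=> x y; rewrite opprK addrC.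
  under eq_bigr do rewrite mulrN; under [X in _ - X]eq_bigr do rewrite mulrN.
  by rewrite !sumrN; lra.
move=> {f} fc; pose mu x := (P ^+ T) k x - pi 0 x.
have [m _ mP] := @Order.TotalTheory.arg_minP _ _ _ k xpredT f' isT.
have -> : \sum_x (P ^+ T) k x * f' x - \sum_x pi 0 x * f' x
    = \sum_x mu x * (f' x - f' m).
  under [RHS]eq_bigr do rewrite mulrBr mulrBl.
  by rewrite !sumrB -!mulr_suml /mu sumrB PT1 pi1 subrr mul0r subr0.
have c0 : 0 <= c by rewrite (le_trans _ (fc m m))// subrr.
apply: (@le_trans _ _ (\sum_(x in [set x | 0 < mu x]%SET) mu x * c)).
  rewrite [leRHS]big_mkcond; apply: ler_sum => x _; rewrite inE.
  have f0 : 0 <= f' x - f' m by rewrite subr_ge0 mP.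
  by case: ltP => mu0; [rewrite ler_wpM2l// ltW|rewrite mulr_le0_ge0].
rewrite -mulr_suml mulrC ler_wpM2l// (le_trans _ T_mix)//.
apply: le_trans (le_bigmax _ (fun x => TV (row x (P ^+ T)) pi) k).
rewrite /mu sumrB (le_trans (ler_norm _))//.
apply: le_trans (le_bigmax _ (fun A : {set 'I_n} =>
  `|\sum_(x in A) (row k (P ^+ T)) 0 x - \sum_(x in A) pi 0 x|) [set x | 0 < mu x]%SET).
rewrite le_eqVlt; apply/orP; left; apply/eqP; congr `| _ - _ |.
by apply: eq_bigr => x _; rewrite mxE.
Qed.

Let iter f k := \sum_x (P ^+ T) k x * f x.

Lemma mixing_osc2 f c k l : (forall x y, f x - f y <= c) ->
  iter f k - iter f l <= c / 2.
Proof.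
move=> fc; have := mixing_osc k fc; have := mixing_osc l fc.
rewrite !ler_norml -/(iter f k) -/(iter f l) => /andP[+ _] /andP[_]; lra.
Qed.

(** At a pair of states realizing the oscillation of f, the equation gives osc f <= c + osc f /
    2. *)
Lemma fixpoint_osc f g c : (forall k, f k = g k + iter f k) ->
  (forall x y, g x - g y <= c) -> forall x y, f x - f y <= 2 * c.
Proof.
move=> fE gc.
have [p _ pP] := @Order.TotalTheory.arg_maxP _ _ _ (i, i) xpredT (fun p => f p.1 - f p.2) isT.
have fO x y : f x - f y <= f p.1 - f p.2 by apply: (pP (x, y)).
move=> x y; apply: le_trans (fO x y) _.
have := mixing_osc2 p.1 p.2 fO; have := gc p.1 p.2; have := fE p.1; have := fE p.2.
lra.
Qed.

Let z k := fundamental_series P pi k i.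

Let z_iter N k : z k = \sum_(t < N) ((P ^+ t) k i - pi 0 i)
  + \sum_y (P ^+ N) k y * z y.
Proof.
elim: N => [|N ->].
  rewrite big_ord0 add0r (bigD1 k)//= expr0 mxE eqxx mul1r big1 ?addr0//.
  by move=> y yj; rewrite mxE eq_sym (negbTE yj) mul0r.
rewrite big_ord_recr/= -addrA; congr (_ + _).
under [in RHS]eq_bigr => y _ do rewrite exprSrE mulr_suml.
rewrite exchange_big/=.
have [_ PN1] := stochastic_exp P_st N.
have e x : z x = (x == i)%:R - pi 0 i + \sum_y P x y * z y.
  by have := poisson_fundamental_series P_st P_irr P_pi x i; rewrite /= /z => <-; rewrite subrK.
under eq_bigr => x _ do rewrite e mulrDr mulr_sumr mulrBr.
rewrite big_split sumrB -mulr_suml PN1 mul1r /=; congr (_ - _ + _).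
  rewrite (bigD1 i)//= eqxx mulr1 big1 ?addr0// => x xi.
  by rewrite (negbTE xi) mulr0.
by apply: eq_bigr => x _; apply: eq_bigr => y _; rewrite mulrA.
Qed.

(** Distinguishes the series from the inverse matrix, for which the same sum is pi_i. *)
Let sum_pi_z : \sum_y pi 0 y * z y = 0.
Proof.
rewrite /z; under eq_bigr do rewrite (fundamental_seriesE P_st P_irr P_pi) mulrBr.
rewrite sumrB (sum_stationary_fundamental_inv P_st P_irr P_pi) -mulr_suml.
by case: P_pi => _ -> _; rewrite mul1r subrr.
Qed.

Lemma Zmax_series_le : Zmax (fundamental_series P pi) i <= 11 / 8 * T%:R.
Proof.
apply/bigmax_leP; split=> [|k _]; first by rewrite mulr_ge0//; lra.
pose S k := \sum_(t < T) ((P ^+ t) k i - pi 0 i).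
pose f := iter z; pose g := iter S; pose p := pi 0 i.
have p0 : 0 < p by exact: (stationary_gt0 P_st P_irr P_pi).
have PT_le1 t x : 0 <= (P ^+ t) x i <= 1.
  have [Pt0 Pt1] := stochastic_exp P_st t.
  by rewrite Pt0 -(Pt1 x) (bigD1 i)//= lerDl sumr_ge0.
have p1 : p <= 1.
  by case: P_pi => pi0 <- _; rewrite (bigD1 i)//= lerDl sumr_ge0.
have T0' : 0 < T%:R :> R by rewrite ltr0n.
have cstE (a : R) : T%:R * a = \sum_(t < T) a.
  by rewrite sumr_const card_ord mulr_natl.
have gE x : g x = \sum_(t < T) ((P ^+ (T + t)) x i - p).
  rewrite /g /iter /S; under eq_bigr do rewrite mulr_sumr.
  rewrite exchange_big/=; apply: eq_bigr => t _.
  rewrite exprD -[_ * _]/(_ *m _) mxE; under eq_bigr do rewrite mulrBr.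
  by rewrite sumrB -mulr_suml (stochastic_exp P_st T).2 mul1r.
(* P^t(., i) takes values in [0, 1], so its oscillation is at most 1. *)
have gT t x : - 4^-1 <= (P ^+ (T + t)) x i - p <= 4^-1.
  have := @mixing_osc (fun y => (P ^+ t) y i) 1 x.
  rewrite (stationary_exp P_pi) ler_norml exprD -[_ ^+ T * _]/(_ *m _) mxE mul1r; apply.
  by move=> a b; have := PT_le1 t a; have := PT_le1 t b; lra.
have gb a b x : (forall t, a <= (P ^+ (T + t)) x i - p <= b) -> T%:R * a <= g x <= T%:R * b.
  move=> ab; rewrite gE !cstE.
  by apply/andP; split; apply: ler_sum => t _; have /andP[] := ab t.
have fE x : f x = g x + iter f x.
  rewrite /f /g /iter -big_split/=; apply: eq_bigr => y _.
  by rewrite -mulrDr (z_iter T y).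
have f_pi : \sum_x pi 0 x * f x = 0.
  rewrite /f /iter -[RHS]sum_pi_z; under eq_bigr do rewrite mulr_sumr.
  rewrite exchange_big/=; apply: eq_bigr => y _.
  by under eq_bigr do rewrite mulrA; rewrite -mulr_suml (stationary_exp P_pi).
(* f - g = P^T f, and since f has pi-mean 0, [mixing_osc] bounds P^T f itself by a quarter of the
   oscillation of f. *)
have fz c : (forall x y, g x - g y <= c) -> - (c / 2) <= f k - g k <= c / 2.
  move=> /(fixpoint_osc fE) /(@mixing_osc _ _ k); rewrite f_pi subr0 -/(iter f k).
  by rewrite ler_norml fE; lra.
have zE : z k = S k + f k by rewrite (z_iter T k).
have Sk : T%:R * (- p) <= S k <= T%:R * (1 - p).
  rewrite !cstE.
  by apply/andP; split; apply: ler_sum => t _; have := PT_le1 t k; rewrite -/p; lra.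
have gk := gb _ _ k (fun t => gT t k).
(* The plain bound T / 2 on the oscillation of g would cost 3/2 for p near 0. Here the upper bound
   on z is T (1 - p + 1/4 + (p + 1/4) / 2) = T (11/8 - p/2). With [h2], the lower bound is - T (p +
   1/4 + (5/4 - p) / 2) = - T (7/8 + p/2). *)
have h1 : forall x y, g x - g y <= T%:R * (p + 4^-1).
  move=> x y; have := gb (- p) 4^-1 y; have := gb (- p) 4^-1 x.
  have q u t : - p <= (P ^+ (T + t)) u i - p <= 4^-1.
    by have := PT_le1 (T + t)%N u; have := gT t u; lra.
  by move=> /(_ (q x)) ? /(_ (q y)) ?; lra.
have h2 : forall x y, g x - g y <= T%:R * (5 / 4 - p).
  move=> x y; have := gb (- 4^-1) (1 - p) y; have := gb (- 4^-1) (1 - p) x.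
  have q u t : - 4^-1 <= (P ^+ (T + t)) u i - p <= 1 - p.
    by have := PT_le1 (T + t)%N u; have := gT t u; lra.
  by move=> /(_ (q x)) ? /(_ (q y)) ?; lra.
have := fz _ h1; have := fz _ h2; rewrite -/(z k) ler_norml.
have := mulr_gt0 T0' p0; have : T%:R * p <= T%:R * 1 :> R by rewrite ler_pM2l.
lra.
Qed.

End Mixing.

(** The factor 11/4 is twice 11/8, from Z i i - Z j i. For j = i the numerator is 1, which T >= 1
    covers. *)
Lemma hitting_sum_mixing {R : realType} {n : nat} (P : 'M[R]_n) (pi : 'rV[R]_n)
    (i : 'I_n) (T : nat) :
  stochastic P -> irreducible P -> stationary P pi -> (0 < T)%N ->
  \big[Num.max/0]_(x < n) TV (row x (P ^+ T)) pi <= 4^-1 ->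
  forall j t, \sum_(s < t) survival P i s j <= 11 / 4 * T%:R / pi 0 i.
Proof.
move=> P_st P_irr P_pi T0 T_mix j t.
have pi0 := stationary_gt0 P_st P_irr P_pi i.
apply: le_trans (sum_survival_le P_st P_irr P_pi
  (fun k => poisson_fundamental_series P_st P_irr P_pi k i) t j) _.
rewrite ler_wpM2r ?invr_ge0 ?(ltW pi0)//.
set Z := fundamental_series P pi.
have ZT k : `|Z k i| <= 11 / 8 * T%:R.
  apply: le_trans (Zmax_series_le i P_st P_irr P_pi T0 T_mix).
  exact: (le_bigmax _ (fun k => `|Z k i|)).
have T1 : 1 <= T%:R :> R by rewrite ler1n.
have [->|ji] := eqVneq j i; first by rewrite subrr add0r ?eqxx mulr1n; lra.
rewrite addr0; have := ZT i; have := ZT j; rewrite !ler_norml => /andP[? _] /andP[_ ?].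
lra.
Qed.

(** * Discrete random variables *)

(** Preimages of all sets, whatever the codomain: any function of such a map, with ceilings and
    logarithms, or even valued in [Prop], is again of this kind. *)
Definition discrete_measurable {d} {T : measurableType d} {S : Type}
  (F : T -> S) := forall A : set S, measurable (F @^-1` A).

Section DiscreteMeasurable.
Context {d} {T : measurableType d}.

Lemma discrete_measurableP (S : countType) (F : T -> S) :
  (forall u, measurable (F @^-1` [set u])) -> discrete_measurable F.
Proof.
move=> Fm A.
have -> : F @^-1` A = \bigcup_u (F @^-1` [set u] `&` [set w | A u]).
  by apply/seteqP; split=> [w Aw|w [u _ [/= <-]]//]; exists (F w).
apply: countable_bigcupT_measurable => // u; apply: measurableI => //.
have [Au|nAu] := pselect (A u); first by rewrite (_ : [set _ | _] = setT)// -subTset.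
by rewrite (_ : [set _ | _] = set0)// -subset0.
Qed.

Lemma discrete_measurable_cst (S : Type) (c : S) :
  discrete_measurable (fun _ : T => c).
Proof.
move=> A; have [Ac|nAc] := pselect (A c).
  by rewrite (_ : _ @^-1` _ = setT)// -subTset.
by rewrite (_ : _ @^-1` _ = set0)// -subset0.
Qed.

Lemma discrete_measurable_comp (S S' : Type) (F : T -> S) (g : S -> S') :
  discrete_measurable F -> discrete_measurable (g \o F).
Proof. by move=> Fm A; apply: (Fm (g @^-1` A)). Qed.

(** For quantities indexed by a random value, such as a sum over a random number of samples. *)
Lemma discrete_measurable_select (S : countType) (S' : Type)
    (F : T -> S) (G : S -> T -> S') :
  discrete_measurable F -> (forall u, discrete_measurable (G u)) ->
  discrete_measurable (fun w => G (F w) w).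
Proof.
move=> Fm Gm A.
have -> : (fun w => G (F w) w) @^-1` A =
    \bigcup_u (F @^-1` [set u] `&` G u @^-1` A).
  by apply/seteqP; split=> [w Aw|w [u _ [/= <-]]//]; exists (F w).
apply: countable_bigcupT_measurable => // u.
by apply: measurableI; [exact: Fm|exact: Gm].
Qed.

Lemma discrete_measurable_map (I : eqType) (S : countType) (f : I -> T -> S)
    (J : seq I) : (forall j, j \in J -> discrete_measurable (f j)) ->
  discrete_measurable (fun w => [seq f j w | j <- J]).
Proof.
elim: J => [_|j J IH fm]; first exact: discrete_measurable_cst.
apply: (@discrete_measurable_select _ _ _ (fun u w => u :: [seq f j w | j <- J])).
  by apply: fm; rewrite inE eqxx.
move=> u; apply: (discrete_measurable_comp (cons u)); apply: IH => k kJ.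
by apply: fm; rewrite inE kJ orbT.
Qed.

End DiscreteMeasurable.

Section DiscreteProbability.
Context {R : realType} {d} {T : measurableType d} (Pr : probability T R).

Lemma probability_total (F : T -> nat) (E : set T) :
  discrete_measurable F -> measurable E ->
  Pr E = (\sum_(0 <= n <oo) Pr (F @^-1` [set n] `&` E))%E.
Proof.
move=> Fm Em.
have {1}-> : E = \bigcup_n (F @^-1` [set n] `&` E).
  by apply/seteqP; split=> [w Ew|w [n _ []]//]; exists (F w).
rewrite measure_bigcup//=.
- by apply: eq_eseriesl => n; rewrite in_setT.
- by move=> n _; apply: measurableI => //; exact: Fm.
- by move=> m n _ _ [w [[/= <- _] [/= <- _]]].
Qed.

Lemma probability_total_bounded (F : T -> nat) (b : nat) (E : set T) :
  (forall w, (F w < b)%N) ->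
  discrete_measurable F -> measurable E ->
  Pr E = (\sum_(l < b) Pr (F @^-1` [set l : nat] `&` E))%E.
Proof.
move=> Fb Fm Em; rewrite (probability_total Fm Em) (nneseries_split 0 b)// add0n.
rewrite big_mkord eseries0 ?adde0// => n bn _.
rewrite (_ : _ `&` _ = set0) ?measure0// -subset0 => w [/= Fw _].
by have := Fb w; rewrite Fw ltnNge bn.
Qed.

(** Extends a product formula from atoms to arbitrary events of F; the encoding of S into [nat]
    reduces the sum over atoms to a series. *)
Lemma probability_factor (S : countType) (F : T -> S) (U : set S) (B : set T)
    (c : R) :
  discrete_measurable F -> measurable B ->
  (forall u, U u -> Pr (F @^-1` [set u] `&` B) = Pr (F @^-1` [set u]) * c%:E)%E ->
  (Pr (F @^-1` U `&` B) = Pr (F @^-1` U) * c%:E)%E.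
Proof.
move=> Fm Bm FB; have pm : discrete_measurable (pickle \o F) by exact: discrete_measurable_comp.
rewrite (probability_total pm (measurableI _ _ (Fm U) Bm)).
rewrite (probability_total pm (Fm U)) muleC -nneseriesZl//.
apply: eq_eseriesr => n _.
have [[w [Uw <-]]|nU] := pselect (exists w, U (F w) /\ pickle (F w) = n).
  have Fw : (pickle \o F) @^-1` [set pickle (F w)] `&` F @^-1` U = F @^-1` [set F w].
    by apply/seteqP; split=> [v [/= /(pcan_inj pickleK)//]|v /= ->].
  by rewrite setIA Fw FB// muleC.
rewrite setIA (_ : _ `&` F @^-1` U = set0) ?set0I ?measure0 ?mule0//.
by rewrite -subset0 => w [/= wn Uw]; apply: nU; exists w.
Qed.

End DiscreteProbability.

Section DiscreteIndependence.
Context {R : realType} {d} {T : measurableType d} (Pr : probability T R).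
Variables (I : choiceType) (tau : I -> T -> nat).
Hypothesis tau_m : forall j, discrete_measurable (tau j).
Hypothesis tau_indep : forall (J : seq I) (l : I -> nat), uniq J ->
  Pr (\big[setI/setT]_(j <- J) tau j @^-1` [set l j]) =
  (\prod_(j <- J) Pr (tau j @^-1` [set l j]))%E.
Let V (J : seq I) w := [seq tau j w | j <- J].

Let Vm J : discrete_measurable (V J).
Proof. by apply: discrete_measurable_map. Qed.

Let V_eq J w : V J @^-1` [set V J w] =
  \big[setI/setT]_(j <- J) tau j @^-1` [set tau j w].
Proof.
rewrite -bigcap_seq; apply/seteqP; split=> [v /= vw j /= jJ|v /= vw].
  by apply/eqP; move/eq_in_map: vw => ->.
by apply/eq_in_map => j jJ; exact: vw.
Qed.

(** On a pair of atoms this is the independence of the coordinates; [probability_factor] then frees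
    one block at a time. *)
Lemma independent_blocks (J1 J2 : seq I) (U1 U2 : set (seq nat)) :
  uniq (J1 ++ J2) ->
  Pr (V J1 @^-1` U1 `&` V J2 @^-1` U2) =
  (Pr (V J1 @^-1` U1) * Pr (V J2 @^-1` U2))%E.
Proof.
move=> uJ; have := uJ; rewrite cat_uniq => /and3P[u1 /hasPn u12 u2].
have p1 u v : Pr (V J1 @^-1` [set u] `&` V J2 @^-1` [set v]) =
  (Pr (V J1 @^-1` [set u]) * Pr (V J2 @^-1` [set v]))%E.
  have [[w1 <-]|nu] := pselect (exists w, V J1 w = u); last first.
    rewrite (_ : V J1 @^-1` _ = set0) ?set0I ?measure0 ?mul0e//.
    by rewrite -subset0 => w wu; apply: nu; exists w.
  have [[w2 <-]|nv] := pselect (exists w, V J2 w = v); last first.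
    rewrite (_ : V J2 @^-1` _ = set0) ?setI0 ?measure0 ?mule0//.
    by rewrite -subset0 => w wv; apply: nv; exists w.
  (* The blocks are disjoint, so one assignment describes both atoms. *)
  pose l j := if j \in J1 then tau j w1 else tau j w2.
  have e1 A op idx (G : I -> nat -> A) : \big[op/idx]_(j <- J1) G j (tau j w1) =
      \big[op/idx]_(j <- J1) G j (l j).
    by apply: eq_big_seq => j jJ; rewrite /l jJ.
  have e2 A op idx (G : I -> nat -> A) : \big[op/idx]_(j <- J2) G j (tau j w2) =
      \big[op/idx]_(j <- J2) G j (l j).
    by apply: eq_big_seq => j /u12 jJ; rewrite /l (negbTE jJ).
  rewrite !V_eq (e1 _ _ _ (fun j x => tau j @^-1` [set x])).
  rewrite (e2 _ _ _ (fun j x => tau j @^-1` [set x])).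
  by rewrite -big_cat/= !tau_indep// big_cat.
have fin A : measurable A -> Pr A = (fine (Pr A))%:E.
  by move=> Am; rewrite fineK// fin_num_measure.
rewrite (fin (V J2 @^-1` U2)); last exact: Vm.
apply: probability_factor; [exact: Vm|exact: Vm|].
move=> u _; rewrite -fin; last exact: Vm.
rewrite [RHS]muleC setIC (fin (V J1 @^-1` [set u])); last exact: Vm.
apply: probability_factor; [exact: Vm|exact: Vm|].
move=> v _; rewrite setIC p1 [RHS]muleC; congr (_ * _)%E.
exact: (fin _ (Vm J1 [set u])).
Qed.

End DiscreteIndependence.

(** * Exponential moments and Chernoff bounds *)

Section Chernoff.
Context {R : realType} {d} {T : measurableType d} (Pr : probability T R).

Definition law (F : T -> nat) (l : nat) : R := fine (Pr (F @^-1` [set l])).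

Section Law.
Variables (F : T -> nat) (b : nat).
Hypotheses (F_b : forall w, (F w < b)%N) (F_m : discrete_measurable F).

Lemma lawE l : Pr (F @^-1` [set l]) = (law F l)%:E.
Proof. by rewrite /law fineK// fin_num_measure//; exact: F_m. Qed.

Lemma law_ge0 l : 0 <= law F l. Proof. exact: fine_ge0. Qed.

Lemma sum_law (U : pred nat) :
  (\sum_(l < b) law F l * (U l)%:R)%:E = Pr [set w | U (F w)].
Proof.
rewrite (probability_total_bounded Pr F_b F_m (F_m [set l | U l])) -sumEFin.
apply: eq_bigr => l _; case: (boolP (U l)) => Ul.
  rewrite mulr1 -lawE; congr (Pr _).
  by apply/seteqP; split=> [w /= wl|w [//]]; rewrite /= wl.
rewrite mulr0 (_ : _ `&` _ = set0) ?measure0// -subset0 => w [/= wl].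
by rewrite wl (negbTE Ul).
Qed.

Lemma sum_law1 : \sum_(l < b) law F l = 1.
Proof.
have := sum_law xpredT; under eq_bigr do rewrite mulr1.
by rewrite (_ : [set _ | _] = setT) ?probability_setT -?subTset// => -[].
Qed.

(** Convexity of exp on [0, 1]: exp (c phi) <= 1 + (exp c - 1) phi. The sign of c is free, so the
    bound serves upper and lower tails alike. *)
Lemma mgf_le (phi : nat -> R) (c : R) : (forall l, 0 <= phi l <= 1) ->
  \sum_(l < b) law F l * expR (c * phi l) <=
  expR ((expR c - 1) * \sum_(l < b) law F l * phi l).
Proof.
move=> phi01.
apply: le_trans (expR_ge1Dx _).
apply: (@le_trans _ _ (\sum_(l < b) law F l * (1 + (expR c - 1) * phi l))).
  apply: ler_sum => l _; rewrite ler_wpM2l ?law_ge0//.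
  have /andP[p0 p1] := phi01 l.
  have := @convex_expR R (Itv01 p0 p1) c 0.
  by rewrite !convRE /= expR0 /unstable.onem mulr0 addr0 mulrC; lra.
under eq_bigr do rewrite mulrDr mulr1 mulrCA.
by rewrite big_split/= sum_law1 mulr_sumr.
Qed.

(** The linear term is centered and the quadratic one has mean (1 + c) / 2 c^2 p (1 - p), where p (1
    - p) <= 1/4. *)
Lemma mgf_bernoulli_le (U : pred nat) (p c : R) : Pr [set w | U (F w)] = p%:E ->
  0 <= c <= 1 ->
  \sum_(l < b) law F l * expR (c * (p - (U l)%:R)) <= expR (c ^+ 2 * (1 + c) / 8).
Proof.
rewrite -sum_law => -[pE] /andP[c0 c1].
have p0 : 0 <= p by rewrite -pE sumr_ge0// => l _; rewrite mulr_ge0 ?law_ge0//.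
have p1 : p <= 1.
  rewrite -pE -[leRHS]sum_law1; apply: ler_sum => l _.
  by rewrite ler_piMr ?law_ge0 ?lern1 ?leq_b1.
pose y l := c * (p - (U l)%:R).
apply: (@le_trans _ _ (\sum_(l < b) (law F l * (1 + c * p + (1 + c) / 2 * (c * p) ^+ 2)
    + law F l * (U l)%:R * ((1 + c) / 2 * c ^+ 2 * (1 - 2 * p) - c)))).
  apply: ler_sum => l _; rewrite -[law F l * (U l)%:R * _]mulrA -mulrDr ler_wpM2l ?law_ge0//.
  rewrite /y; set u : R := (U l)%:R.
  have [u0 u1 uu] : [/\ 0 <= u, u <= 1 & u * u = u].
    by rewrite /u; case: (U l); split; rewrite ?mulr1 ?mulr0 ?ler01.
  have yc : `|c * (p - u)| <= c.
    by rewrite normrM ger0_norm// ler_piMr// ler_norml; apply/andP; split; lra.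
  apply: (le_trans (expR_le_quadratic c1 yc)).
  have -> : (c * (p - u)) ^+ 2 = c ^+ 2 * (p ^+ 2 - 2 * p * u + u * u) by ring.
  rewrite uu; lra.
rewrite big_split/= -!mulr_suml pE sum_law1.
apply: le_trans (expR_ge1Dx _).
have : 0 <= (1 + c) * c ^+ 2 * (1 - 2 * p) ^+ 2.
  by rewrite mulr_ge0 ?sqr_ge0// mulr_ge0 ?sqr_ge0//; lra.
lra.
Qed.

End Law.

(* Induction on N, conditioning on the last sample, uses nothing but finite
   sums. *)
Lemma chernoff (tau : nat -> T -> nat) (b : nat) (psi : nat -> R) (M : R) :
  (forall s w, (tau s w < b)%N) -> (forall s, discrete_measurable (tau s)) ->
  (forall N (U : set (seq nat)) l, let V w := [seq tau s w | s <- iota 0 N] in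
    Pr (V @^-1` U `&` tau N @^-1` [set l]) =
    (Pr (V @^-1` U) * Pr (tau N @^-1` [set l]))%E) ->
  (forall s, \sum_(l < b) law (tau s) l * expR (psi l) <= M) ->
  forall N a, (Pr [set w | a <= \sum_(s < N) psi (tau s w)]%R <=
    (expR (- a) * M ^+ N)%:E)%E.
Proof.
move=> tb tm indep mgf; elim=> [|N IH] a.
  under eq_set do rewrite big_ord0.
  rewrite expr0 mulr1; have [a0|a0] := leP a 0.
    rewrite (_ : [set _ | _] = setT) ?probability_setT -?subTset//.
    by rewrite lee_fin -expR0 ler_expR oppr_ge0.
  by rewrite (_ : [set _ | _] = set0) ?measure0 ?lee_fin ?expR_ge0// -subset0.
pose U a := [set u : seq nat | (a <= \sum_(l <- u) psi l)%R].
pose V N w := [seq tau s w | s <- iota 0 N].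
have VE N' a' : [set w | (a' <= \sum_(s < N') psi (tau s w))%R] = V N' @^-1` U a'.
  apply/seteqP; split=> w /=; rewrite /U/V/= big_map;
  by rewrite -[N' in iota _ N']subn0 -/(index_iota 0 N') big_mkord.
have Vm N' : discrete_measurable (V N') by apply: discrete_measurable_map => j _; exact: tm.
rewrite VE (probability_total_bounded Pr (tb N) (tm N))//; last exact: Vm.
apply: (@le_trans _ _ (\sum_(l < b) (law (tau N) l * expR (- (a - psi l)) * M ^+ N)%:E)%E).
  apply: lee_sum => l _.
  have -> : tau N @^-1` [set l : nat] `&` V N.+1 @^-1` U a =
      V N @^-1` U (a - psi l) `&` tau N @^-1` [set l : nat].
    rewrite -!VE [RHS]setIC; apply/seteqP.
    by split=> w [/= wl]; rewrite big_ord_recr/= wl lerBlDr.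
  rewrite indep lawE; last exact: tm.
  rewrite muleC -mulrA EFinM lee_wpmul2l ?lee_fin ?law_ge0// -VE; exact: IH.
rewrite sumEFin lee_fin exprS mulrA -mulr_suml ler_wpM2r//.
  apply: exprn_ge0; apply: le_trans (mgf 0%N); rewrite sumr_ge0// => l _.
  by rewrite mulr_ge0 ?law_ge0 ?expR_ge0.
rewrite -ler_pdivrMl ?expR_gt0// -expRN opprK mulr_sumr.
apply: le_trans (mgf N); apply: ler_sum => l _.
rewrite mulrCA -expRD; apply: ler_wpM2l; first exact: law_ge0.
by rewrite ler_expR; lra.
Qed.

End Chernoff.

(** * Return times of a Markov chain *)

(* min(T_i, th + 1): the value th + 1 means that there is no return by time th. *)
Definition first_return {S : eqType} (i : S) (th : nat) (x : nat -> S) : nat :=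
  (find (fun t => x t.+1 == i) (iota 0 th)).+1.

Section ReturnTime.
Context {R : realType} {S : eqType} (i : S).
Implicit Types (x : nat -> S) (t s th : nat).

Definition no_return t x := forall s, (0 < s <= t)%N -> x s <> i.

Lemma first_return_le th x : (first_return i th x <= th.+1)%N.
Proof. by rewrite ltnS -[leqRHS](size_iota 0 th) find_size. Qed.

Lemma first_return_gtP t th x : (t <= th)%N ->
  reflect (no_return t x) (t < first_return i th x)%N.
Proof.
move=> tth; rewrite ltnS leqNgt -has_take_leq ?size_iota// take_iota.
rewrite (minn_idPl tth); apply: (iffP hasPn) => [h s /andP[s0 st] xs|h s].
  have /h : s.-1 \in iota 0 t by rewrite mem_iota add0n prednK.
  by rewrite prednK// xs eqxx.
rewrite mem_iota add0n => /andP[_ st]; apply/eqP; exact: h.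
Qed.

Variant return_time_spec x : \bar R -> Prop :=
  | ReturnTimeFin t of (0 < t)%N & x t = i & no_return t.-1 x :
      return_time_spec x t%:R%:E
  | ReturnTimeInf of (forall t, no_return t x) : return_time_spec x +oo%E.

Lemma return_timeP x : return_time_spec x (return_time i x).
Proof.
have [ex|nex] := pselect (exists t, (0 < t)%N && (x t == i)); last first.
  rewrite /return_time (_ : [set _ | _ in _] = set0) ?ereal_inf0.
    by apply: ReturnTimeInf => t s /andP[s0 _] xs; apply: nex; exists s; rewrite s0 xs eqxx.
  by rewrite -subset0 => y [t [t0 xt] _]; apply: nex; exists t; rewrite t0 xt eqxx.
have [t /andP[t0 /eqP xt] tmin] := ex_minnP ex.
rewrite (_ : return_time i x = t%:R%:E).
  apply: ReturnTimeFin => // s /andP[s0 st] /eqP xs.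
  by have := tmin s; rewrite s0 xs => /(_ isT); lia.
apply/eqP; rewrite eq_le; apply/andP; split.
  by apply: ereal_inf_lbound; exists t.
apply: le_ereal_inf_tmp => _ [s [s0 /eqP xs] <-].
by rewrite lee_fin ler_nat tmin// s0.
Qed.

Lemma return_time_gtP t x : (t%:R%:E < return_time i x :> \bar R)%E <-> no_return t x.
Proof.
case: return_timeP => [u u0 xu nr|nr]; last by rewrite ltry; split.
rewrite lte_fin ltr_nat; split=> [tu s /andP[s0 st]|tu].
  by apply: nr; rewrite s0; lia.
by rewrite ltnNge; apply/negP => ut; apply: (tu u); rewrite ?u0.
Qed.

(** Layer-cake form, also valid when there is no return; it integrates termwise to the survival
    probabilities. *)
Lemma return_time_series x :
  return_time i x = (\sum_(0 <= t <oo) (\1_[set y | no_return t y] x)%:E : \bar R)%E.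
Proof.
case: return_timeP => [u u0 xu nr|nr].
  rewrite (nneseries_split 0 u)//.
  rewrite add0n eseries0 ?adde0; last first.
    move=> t ut _; rewrite indicE memNset// => /(_ u); apply => //; by rewrite u0.
  rewrite big_nat (eq_bigr (fun=> 1%E)); last first.
    move=> t /andP[_ tu]; rewrite indicE mem_set// => s /andP[s0 st].
    by apply: nr; rewrite s0; lia.
  by rewrite -big_nat sumEFin big_const_nat subn0 iter_addr_0.
apply/esym/eqyP => r r0; apply: le_trans (nneseries_lim_ge (Num.trunc r).+1 _); last first.
  by move=> t _ _; rewrite lee_fin.
rewrite (eq_bigr (fun=> 1%E)) => [|t _]; last by rewrite indicE mem_set//; exact: nr.
rewrite sumEFin big_const_nat subn0 iter_addr_0 lee_fin.
by apply/ltW; rewrite truncnS_gt.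
Qed.

End ReturnTime.

(** * Law of the return time of a chain *)

Section ChainLaw.
Context {R : realType} {n : nat} {d} {Omega : measurableType d}
  (Pr : probability Omega R).
Variables (P : 'M[R]_n) (i j : 'I_n) (X : nat -> Omega -> 'I_n).
Hypotheses (P_st : stochastic P) (X_P : markov_chain_from Pr P j X).

Lemma markov_chain_measurable t : discrete_measurable (X t).
Proof. by case: X_P => Xm _ _; apply: discrete_measurableP => x; exact: Xm. Qed.

Let W t w := [seq X s w | s <- iota 0 t.+1].

Let Wm t : discrete_measurable (W t).
Proof. by apply: discrete_measurable_map => s _; exact: markov_chain_measurable. Qed.

Let W_nth t w s : (s <= t)%N -> nth j (W t w) s = X s w.
Proof. by move=> st; rewrite (nth_map 0%N) ?nth_iota ?size_iota. Qed.

Let W_eq t w v : (forall s, (s <= t)%N -> X s w = X s v) <-> W t w = W t v.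
Proof.
split=> [h|h s st]; last by rewrite -(W_nth w st) -(W_nth v st) h.
by apply/eq_in_map => s; rewrite mem_iota add0n ltnS => /h.
Qed.

(** The defining clause of the chain concerns a single prefix; it is summed over all prefixes in U,
    which end at the same state x. *)
Lemma markov_property t (U : set (seq 'I_n)) x y :
  (forall u, U u -> nth j u t = x) ->
  Pr (W t @^-1` U `&` X t.+1 @^-1` [set y]) = (Pr (W t @^-1` U) * (P x y)%:E)%E.
Proof.
move=> Ux; apply: probability_factor; [exact: Wm|exact: markov_chain_measurable|].
move=> u /Ux ux; have [[v vu]|nu] := pselect (exists v, W t v = u); last first.
  rewrite (_ : W t @^-1` _ = set0) ?set0I ?measure0 ?mul0e//.
  by rewrite -subset0 => w wu; apply: nu; exists w.
case: X_P => _ _ /(_ t (fun s => if (s <= t)%N then X s v else y)).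
rewrite ltnn leqnn -(W_nth v (leqnn t)) vu ux => h.
rewrite [X in (Pr X * _)%E](_ : _ =
    [set w | forall s, (s <= t)%N -> X s w = (if (s <= t)%N then X s v else y)]); last first.
  rewrite -vu; apply/seteqP; split=> w /=.
    by move=> /W_eq h' s st; rewrite st h'.
  by move=> h'; apply/W_eq => s st; rewrite h'// st.
rewrite -h; congr (Pr _); rewrite -vu; apply/seteqP; split=> w /=.
  move=> [/W_eq h' wy] s; rewrite leq_eqVlt => /orP[/eqP ->|st].
    by rewrite ltnn.
  by rewrite -ltnS st h'.
move=> h'; split; last by rewrite h'// ltnn.
by apply/W_eq => s st; rewrite h' ?st// (leq_trans st).
Qed.

Lemma taboo_probability t y :
  Pr [set w | no_return i t (X^~ w) /\ X t w = y] = ((taboo P i ^+ t) j y)%:E.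
Proof.
have Em u z : measurable [set w | no_return i u (X^~ w) /\ X u w = z].
  rewrite (_ : [set _ | _] = W u @^-1` [set v |
      (forall s, (0 < s <= u)%N -> nth j v s <> i) /\ nth j v u = z]); first exact: Wm.
  apply/seteqP; split=> w /= [h wz]; (split; last by rewrite -wz W_nth) => s /andP[s0 su].
    by rewrite W_nth//; apply: h; rewrite s0.
  by have := h s; rewrite W_nth// s0 su => /(_ isT).
elim: t y => [|t IH] y.
  rewrite expr0 mxE; case: X_P => _ X0 _.
  have [<-|jy] := eqVneq j y.
    rewrite mulr1n -[RHS]X0; congr (Pr _); apply/seteqP; split=> w /=; first by case.
    by move=> wj; split=> // s; lia.
  (* The chain starts at j only almost surely, so the event is null but possibly nonempty. *)
  rewrite mulr0n; apply/eqP; rewrite -measure_le0.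
  apply: (@le_trans _ _ (Pr (~` (X 0%N @^-1` [set j])))).
    apply: le_measure; rewrite ?inE//.
      by apply: measurableC; exact: markov_chain_measurable.
    by move=> w /= [_ wy] wj; rewrite -wy wj eqxx in jy.
  by rewrite probability_setC ?X0 ?subee//; exact: markov_chain_measurable.
have [->|yi] := eqVneq y i.
  rewrite taboo_col0//; rewrite (_ : [set _ | _] = set0) ?measure0//.
  by rewrite -subset0 => w /= [h wi]; apply: (h t.+1) => //; rewrite leqnn.
have Xt_b w : (nat_of_ord (X t w) < n)%N by exact: ltn_ord.
have Xt_m : discrete_measurable (@nat_of_ord n \o X t).
  exact/discrete_measurable_comp/markov_chain_measurable.
rewrite (probability_total_bounded Pr Xt_b Xt_m)// exprSrE -sumEFin.
apply: eq_bigr => x _; rewrite mxE yi mulr1n EFinM -IH.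
pose U := [set v | (forall s, (0 < s <= t)%N -> nth j v s <> i) /\ nth j v t = x].
have WU : W t @^-1` U = [set w | no_return i t (X^~ w) /\ X t w = x].
  apply/seteqP; split=> w /= [h wz]; (split; last by rewrite -wz W_nth) => s /andP[s0 st].
    by have := h s; rewrite W_nth// s0 st => /(_ isT).
  by rewrite W_nth//; apply: h; rewrite s0.
rewrite -WU -(@markov_property t U x y); last by move=> v [].
congr (Pr _); rewrite WU; apply/seteqP; split=> w /=.
  move=> [/ord_inj wx [h wy]]; do !split=> //.
  by move=> s /andP[s0 st]; apply: h; rewrite s0 ltnW.
move=> [[h wx] wy]; split; first by rewrite wx.
split=> // s /andP[s0]; rewrite leq_eqVlt => /orP[/eqP ->|st].
  by rewrite wy; apply/eqP.
by apply: h; rewrite s0.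
Qed.

Lemma no_return_measurable t : measurable [set w | no_return i t (X^~ w)].
Proof.
rewrite (_ : [set _ | _] = W t @^-1` [set v |
      forall s, (0 < s <= t)%N -> nth j v s <> i]); first exact: Wm.
apply/seteqP; split=> w /= h s /andP[s0 st].
  by rewrite W_nth//; apply: h; rewrite s0.
by have := h s; rewrite W_nth// s0 st => /(_ isT).
Qed.

Lemma survival_probability t :
  Pr [set w | no_return i t (X^~ w)] = (survival P i t j)%:E.
Proof.
have Xt_b w : (nat_of_ord (X t w) < n)%N by exact: ltn_ord.
have Xt_m : discrete_measurable (@nat_of_ord n \o X t).
  exact/discrete_measurable_comp/markov_chain_measurable.
rewrite (probability_total_bounded Pr Xt_b Xt_m (no_return_measurable t)) -sumEFin.
apply: eq_bigr => x _; rewrite -taboo_probability; congr (Pr _).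
by apply/seteqP; split=> w /= [? ?]; split=> //; [exact: ord_inj|congr (nat_of_ord _)].
Qed.

Lemma expected_return_time : (\int[Pr]_w return_time i (X^~ w) =
  \sum_(0 <= t <oo) (survival P i t j)%:E)%E.
Proof.
under eq_integral do rewrite return_time_series.
rewrite integral_nneseries//.
- apply: eq_eseriesr => t _; rewrite -survival_probability -[X in _ = Pr X]setIT.
  by rewrite -integral_indic//; exact: no_return_measurable.
- move=> t; apply/measurable_EFinP/measurable_indic; exact: no_return_measurable.
Qed.

End ChainLaw.

(** Replaces the extended real H_i by the real supremum of the partial survival sums, in terms of
    which the remaining estimates are phrased. *)
Lemma max_hitting_time_fin {R : realType} {n : nat} {d} {Omega : measurableType d}
    (P : 'M[R]_n) (Q : 'I_n -> probability Omega R) (Y : nat -> Omega -> 'I_n)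
    (i : 'I_n) (c : R) :
  stochastic P -> (forall j, markov_chain_from (Q j) P j Y) ->
  (forall j t, \sum_(s < t) survival P i s j <= c) ->
  exists h : R, [/\ max_hitting_time Q Y i = h%:E,
    forall j t, \sum_(s < t) survival P i s j <= h &
    forall b, (forall j t, \sum_(s < t) survival P i s j <= b) -> h <= b].
Proof.
move=> P_st QY cP.
have Hc b : (forall j t, \sum_(s < t) survival P i s j <= b) ->
    (max_hitting_time Q Y i <= b%:E)%E.
  move=> bP; apply/bigmax_leP; split=> [|j _]; first exact: leNye.
  rewrite (expected_return_time _ (QY j)); apply: lime_le.
    by apply: is_cvg_nneseries => t _ _; rewrite lee_fin survival_ge0.
  by apply: nearW => t; rewrite sumEFin lee_fin big_mkord.
have Hs j t : ((\sum_(s < t) survival P i s j)%:E <= max_hitting_time Q Y i)%E.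
  apply: le_trans (le_bigmax _ (fun j => \int[Q j]_w return_time i (Y^~ w))%E j).
  rewrite (expected_return_time _ (QY j)) -sumEFin.
  rewrite -(big_mkord xpredT (fun s => (survival P i s j)%:E)).
  by apply: nneseries_lim_ge => s _ _; rewrite lee_fin survival_ge0.
have Hf : max_hitting_time Q Y i \is a fin_num.
  rewrite fin_numE; apply/andP; split.
    by apply/eqP => H; have := Hs i 0%N; rewrite H.
  by apply/eqP => H; have := Hc c cP; rewrite H.
exists (fine (max_hitting_time Q Y i)); rewrite fineK//; split=> // [j t|b bP].
  by rewrite -lee_fin fineK.
by rewrite -lee_fin fineK// Hc.
Qed.

(** * Sample sizes along one run *)

Section Samples.
Context {R : realType} {S : eqType} (i : S) (x : nat -> nat -> nat -> S).
Local Notation tau k s := (first_return i (theta k) (x k s)).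

(** The cap theta + 1 in [first_return] separates a return at time theta from a truncation; the
    sample length forgets this distinction. *)
Lemma sample_lengthE k s :
  sample_length i x k s = (minn (tau k s) (theta k))%:R :> R.
Proof.
have gt t := @first_return_gtP _ i t (theta k) (x k s).
rewrite /sample_length; case: return_timeP => [t t0 xt nr|nr]; last first.
  rewrite min_r ?leey//=; congr _%:R; apply/esym/minn_idPr/ltnW.
  exact/(gt _ (leqnn _)).
rewrite -EFin_min/= -natr_min; congr _%:R.
have [tth|tht] := leqP t (theta k).
  have -> : tau k s = t; last by rewrite minEnat.
  apply/eqP; rewrite eqn_leq; apply/andP; split.
    by rewrite leqNgt; apply/(gt _ tth) => /(_ t); rewrite t0 leqnn; apply.
  by rewrite -(prednK t0); apply/(gt t.-1); [lia|exact: nr].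
rewrite minEnat (minn_idPr (ltnW tht)); apply/esym/minn_idPr/ltnW.
apply/(gt _ (leqnn _)) => u /andP[u0 uth]; apply: nr; rewrite u0; lia.
Qed.

Lemma sample_truncatedE k s :
  @sample_truncated R S i x k s = (theta k < tau k s)%N.
Proof.
apply/idP/idP => [/return_time_gtP|] h; last apply/return_time_gtP.
  exact/first_return_gtP.
by apply/(@first_return_gtP _ i _ (theta k)).
Qed.

Lemma mean_lengthE k N : mean_length i x k N =
  N%:R^-1 * \sum_(s < N) (minn (tau k s) (theta k))%:R :> R.
Proof. by congr (_ * _); apply: eq_bigr => s _; exact: sample_lengthE. Qed.

Lemma phatE (eps alpha : R) k :
  phat i eps alpha x k = (sample_size i eps alpha x k)%:R^-1 *
    \sum_(s < sample_size i eps alpha x k) (theta k < tau k s)%N%:R.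
Proof.
by congr (_ * _); apply: eq_bigr => s _; rewrite sample_truncatedE.
Qed.

Lemma theta_gt0 k : (0 < theta k)%N. Proof. by rewrite expn_gt0. Qed.

Lemma mean_length_ge1 k N : (0 < N)%N -> 1 <= mean_length i x k N :> R.
Proof.
move=> N0; rewrite mean_lengthE ler_pdivlMl ?ltr0n// mulr1.
rewrite -[N in N%:R]card_ord -sum1_card natr_sum; apply: ler_sum => s _.
by rewrite ler_nat leq_min theta_gt0.
Qed.

Lemma mean_length_le k N : mean_length i x k N <= (theta k)%:R :> R.
Proof.
rewrite mean_lengthE; have [->|N0] := posnP N.
  by rewrite invr0 mul0r.
rewrite ler_pdivrMl ?ltr0n// -natr_sum -natrM ler_nat.
rewrite -[N in (N * _)%N]card_ord -sum_nat_const; apply: leq_sum => s _.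
exact: geq_minr.
Qed.

End Samples.

Lemma le_natr_abs_ceil {R : realType} (y : R) : y <= `|Num.ceil y|%N%:R.
Proof.
rewrite natr_absz; apply: le_trans (ceil_ge _) _.
by rewrite ler_int lez_abs.
Qed.

Lemma natr_abs_ceil_le {R : realType} (y : R) : 0 <= y ->
  `|Num.ceil y|%N%:R <= y + 1.
Proof.
move=> y0; rewrite natr_absz ger0_norm; last by rewrite ceil_ge0; lra.
by have := ceilB1_lt y; rewrite intrB; lra.
Qed.

Section SampleSize.
Context {R : realType} {S : eqType} (i : S) (x : nat -> nat -> nat -> S)
  (eps alpha : R).
Hypotheses (eps01 : 0 < eps < 1) (alpha01 : 0 < alpha < 1).
Local Notation N k := (sample_size i eps alpha x k).
Local Notation T k := (That i eps alpha x k).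

(** The initial sample size has the same form, as 4 * [theta 0] = 8. *)
Definition log_threshold k : R := ln (4 * (theta k)%:R / alpha).

Lemma log_threshold_gt1 k : 1 < log_threshold k.
Proof.
have /andP[a0 a1] := alpha01.
rewrite -ltr_expR lnK ?posrE ?divr_gt0 ?mulr_gt0 ?ltr0n ?theta_gt0//.
have e3 := @expR_le_pade R 1 ler01.
apply: (@lt_le_trans _ _ 4); first by lra.
rewrite ler_pdivlMr//; have : 1 <= (theta k)%:R :> R by rewrite ler1n theta_gt0.
by nra.
Qed.

Lemma log_threshold0 : ln (8 / alpha) = log_threshold 0.
Proof. by congr (ln (_ / _)); rewrite /theta expn1 -natrM. Qed.

Lemma expR_log_threshold k : expR (- log_threshold k) = alpha / 4 / (theta k)%:R.
Proof.
have /andP[a0 a1] := alpha01; have t0 : 0 < (theta k)%:R :> R by rewrite ltr0n theta_gt0.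
rewrite expRN lnK ?posrE ?divr_gt0 ?mulr_gt0//; field.
by rewrite !gt_eqF.
Qed.

Let lt0L k : 0 < log_threshold k.
Proof. by have := log_threshold_gt1 k; lra. Qed.

Lemma sample_size0_ge : 6 * (1 + eps) * log_threshold 0 <= (N 0)%:R * eps ^+ 2.
Proof.
have /andP[e0 e1] := eps01.
rewrite -ler_pdivrMr ?exprn_gt0//=; rewrite -log_threshold0; exact: le_natr_abs_ceil.
Qed.

Lemma sample_size_gt0 k : (0 < N k)%N.
Proof.
have /andP[e0 e1] := eps01; have e2 : 0 < eps ^+ 2 by rewrite exprn_gt0.
elim: k => [|k IH]; rewrite -(ltr0n R).
  rewrite -(pmulr_lgt0 _ e2); apply: lt_le_trans sample_size0_ge.
  by rewrite !mulr_gt0//; lra.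
apply: lt_le_trans (le_natr_abs_ceil _).
have m1 := @mean_length_ge1 R _ i x k _ IH.
apply: divr_gt0; last by rewrite mulr_gt0 ?exprn_gt0//; lra.
by rewrite mulr_gt0 ?lt0L// mulr_gt0 ?ltr0n ?theta_gt0//; lra.
Qed.

Lemma That_ge1 k : 1 <= T k.
Proof. exact/mean_length_ge1/sample_size_gt0. Qed.

Lemma That_le k : T k <= (theta k)%:R.
Proof. exact: mean_length_le. Qed.

Lemma sample_sizeS_ge k : 3 * (1 + eps) * (theta k.+1)%:R * log_threshold k.+1
  <= (N k.+1)%:R * (T k * eps ^+ 2).
Proof.
have /andP[e0 e1] := eps01; have T1 := That_ge1 k.
have d0 : 0 < T k * eps ^+ 2 by rewrite mulr_gt0 ?exprn_gt0//; lra.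
by rewrite -ler_pdivrMr//; exact: le_natr_abs_ceil.
Qed.

(** Holds on every trajectory: That is at most [theta k], half of the next threshold, which doubles
    the factor 3. *)
Lemma sample_size_ge k : 6 * (1 + eps) * log_threshold k <= (N k)%:R * eps ^+ 2.
Proof.
have /andP[e0 e1] := eps01.
case: k => [|k]; first exact: sample_size0_ge.
have T0 : 0 < T k by have := That_ge1 k; lra.
rewrite -(ler_pM2r T0) -[leRHS]mulrA [eps ^+ 2 * _]mulrC.
apply: le_trans (sample_sizeS_ge k).
have -> : (theta k.+1)%:R = 2 * (theta k)%:R :> R by rewrite /theta expnS natrM.
have := ler_wpM2l (ltW (mulr_gt0 (_ : 0 < 6 * (1 + eps)) (lt0L k.+1))) (That_le k).
by move=> /(_ ltac:(lra)); lra.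
Qed.

Lemma sample_size0_le : (N 0)%:R <= 6 * (1 + eps) * log_threshold 0 / eps ^+ 2 + 1.
Proof.
have /andP[e0 e1] := eps01.
rewrite -log_threshold0; apply: natr_abs_ceil_le; rewrite log_threshold0.
apply: divr_ge0; last by rewrite exprn_ge0// ltW.
by rewrite mulr_ge0 ?(ltW (lt0L 0))//; lra.
Qed.

Lemma sample_sizeS_le k : (N k.+1)%:R <=
  3 * (1 + eps) * (theta k.+1)%:R * log_threshold k.+1 / (T k * eps ^+ 2) + 1.
Proof.
have /andP[e0 e1] := eps01; have T1 := That_ge1 k.
apply: natr_abs_ceil_le; rewrite -/(T k).
apply: divr_ge0; last by rewrite mulr_ge0 ?exprn_ge0//; lra.
by rewrite mulr_ge0 ?(ltW (lt0L k.+1))// mulr_ge0 ?ler0n//; lra.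
Qed.

Section Concentrated.
Variable mu : nat -> R.
Hypotheses (mu_ge1 : forall k, 1 <= mu k) (mu_homo : forall k, mu k <= mu k.+1).

(** Just enough samples of mean mu k in [0, theta k] for a Chernoff exponent of rate eps^2 / 3 to
    reach [log_threshold k]. *)
Definition large_sample k m :=
  3 * (theta k)%:R * log_threshold k <= m%:R * mu k * eps ^+ 2.

Lemma large_sample0 : large_sample 0 (N 0).
Proof.
have /andP[e0 e1] := eps01; rewrite /large_sample.
have -> : (theta 0)%:R = 2 :> R by rewrite /theta expn1.
have h := sample_size0_ge; have L0 := lt0L 0.
have : (N 0)%:R * eps ^+ 2 * 1 <= (N 0)%:R * eps ^+ 2 * mu 0.
  by rewrite ler_wpM2l ?mu_ge1// mulr_ge0 ?exprn_ge0 ?ler0n// ltW.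
have := mulr_gt0 e0 L0; lra.
Qed.

Lemma large_sampleS k : T k <= (1 + eps) * mu k -> large_sample k.+1 (N k.+1).
Proof.
have /andP[e0 e1] := eps01; rewrite /large_sample => Tk.
have h := sample_sizeS_ge k.
have e2 : 0 <= (N k.+1)%:R * eps ^+ 2 :> R by rewrite mulr_ge0 ?exprn_ge0 ?ler0n// ltW.
have e3 : 0 < 1 + eps by lra.
rewrite -(ler_pM2l e3); apply: le_trans (le_trans h _); first by lra.
have := ler_wpM2l e2 Tk.
have := ler_wpM2l (mulr_ge0 e2 (ltW e3)) (mu_homo k); lra.
Qed.

Lemma large_sampleP : (forall k, large_sample k (N k) -> T k <= (1 + eps) * mu k) ->
  forall k, large_sample k (N k).
Proof.
move=> h; elim=> [|k /h IH]; first exact: large_sample0.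
exact: large_sampleS.
Qed.

(** Up to rounding, iteration k + 1 costs 3 (1 + eps) theta L / eps^2 times the ratio of successive
    estimates, and That(k+1) <= 2 mu(k+1) <= 4 mu(k) <= 16 That(k). Hence 6 * 16, plus 1 for the
    ceiling. *)
Lemma steps_le : (forall k, mu k.+1 <= 2 * mu k) ->
  (forall k, mu k / 4 <= T k <= (1 + eps) * mu k) ->
  forall k, (N k)%:R * T k <= 97 * (theta k)%:R * log_threshold k / eps ^+ 2.
Proof.
move=> mu2 muT k; have /andP[e0 e1] := eps01.
have e2 : 0 < eps ^+ 2 by rewrite exprn_gt0.
have e21 : eps ^+ 2 <= 1 by rewrite expr_le1// ltW.
have L1 := log_threshold_gt1 k.
have th1 : 1 <= (theta k)%:R :> R by rewrite ler1n theta_gt0.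
have thL : (theta k)%:R <= (theta k)%:R * log_threshold k by rewrite ler_peMr//; lra.
have thLe : (theta k)%:R <= (theta k)%:R * log_threshold k / eps ^+ 2.
  rewrite ler_pdivlMr// (le_trans _ thL)// ler_piMr//; lra.
have Tth := That_le k; have T1 := That_ge1 k.
case: k => [|k] in L1 th1 thL thLe Tth T1 *.
  have h := sample_size0_le; set Y := log_threshold 0 / eps ^+ 2 in thLe *.
  have Y0 : 0 <= Y by rewrite divr_ge0 ?ltW//; lra.
  have h2 : (N 0)%:R <= 12 * Y + 1.
    apply: le_trans h _; rewrite -mulrA -/Y.
    by have := ler_wpM2r Y0 (_ : 6 * (1 + eps) <= 12); move=> /(_ ltac:(lra)); lra.
  apply: (@le_trans _ _ ((12 * Y + 1) * (theta 0)%:R)).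
    by apply: ler_pM => //; lra.
  rewrite -mulrA -/Y in thLe; rewrite -[X in _ <= X]mulrA -/Y; lra.
have h := sample_sizeS_le k; have Tk1 := That_ge1 k.
have TT : T k.+1 <= 16 * T k.
  have /andP[_ a] := muT k.+1; have /andP[b _] := muT k; have c := mu2 k.
  apply: le_trans a _; apply: (@le_trans _ _ (2 * mu k.+1)); last by lra.
  by rewrite ler_wpM2r//; have := mu_ge1 k.+1; lra.
set Y := (theta k.+1)%:R * log_threshold k.+1 / eps ^+ 2 in thLe *.
have Y0 : 0 <= Y by lra.
have h2 : (N k.+1)%:R * T k.+1 <= 6 * Y / T k * T k.+1 + T k.+1.
  rewrite -[X in _ + X]mul1r -mulrDl ler_wpM2r//; first by lra.
  apply: (le_trans h); rewrite lerD2r.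
  have -> : 3 * (1 + eps) * (theta k.+1)%:R * log_threshold k.+1 / (T k * eps ^+ 2)
     = 3 * (1 + eps) * Y / T k.
    by rewrite /Y; field; rewrite !gt_eqF//; lra.
  by rewrite ler_wpM2r ?invr_ge0 ?ler_wpM2r//; lra.
apply: (le_trans h2).
have h3 : 6 * Y / T k * T k.+1 <= 96 * Y.
  rewrite -mulrA [_^-1 * _]mulrC.
  have : T k.+1 / T k <= 16 by rewrite ler_pdivrMr//; lra.
  by move/(ler_wpM2l (_ : 0 <= 6 * Y)) => /(_ ltac:(lra)); lra.
rewrite /Y in h3 thLe *; lra.
Qed.

(** Thresholds double, so all iterations up to K cost at most twice the bound for the last: 194 = 2
    * 97. *)
Lemma total_steps_le delta K : (forall k, mu k.+1 <= 2 * mu k) ->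
  (forall k, mu k / 4 <= T k <= (1 + eps) * mu k) ->
  phat i eps alpha x K < delta ->
  (total_steps i eps alpha x delta <=
   (194 * (theta K)%:R * log_threshold K / eps ^+ 2)%:E)%E.
Proof.
move=> mu2 muT Kd; have /andP[e0 e1] := eps01; have /andP[a0 a1] := alpha01.
have NT0 k : 0 <= (N k)%:R * T k.
  by rewrite mulr_ge0 ?ler0n//; have := That_ge1 k; lra.
rewrite /total_steps (nneseries_split_cond 0 K.+1); last first.
  by move=> k _; rewrite lee_fin.
rewrite [X in (_ + X)%E]eseries0 ?adde0; last first.
  move=> k Kk /allP/(_ K); rewrite mem_iota add0n/= => /(_ Kk).
  by rewrite leNgt Kd.
rewrite sumEFin lee_fin add0n.
have c0 : 0 <= 97 * log_threshold K / eps ^+ 2.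
  by rewrite divr_ge0 ?exprn_ge0 ?mulr_ge0// ltW// lt0L.
apply: (@le_trans _ _ (\sum_(0 <= k < K.+1) 97 * log_threshold K / eps ^+ 2 * (theta k)%:R)).
  rewrite big_mkcond big_nat [leRHS]big_nat; apply: ler_sum => k /andP[_ kK].
  case: ifP => _; last by rewrite mulr_ge0.
  apply: (le_trans (steps_le mu2 muT k)).
  have -> : 97 * (theta k)%:R * log_threshold k / eps ^+ 2 =
    97 * log_threshold k / eps ^+ 2 * (theta k)%:R by ring.
  rewrite ler_wpM2r ?ler0n// ler_wpM2r ?invr_ge0 ?exprn_ge0// ?(ltW e0)//.
  rewrite ler_wpM2l// ler_ln ?posrE ?divr_gt0 ?mulr_gt0 ?ltr0n ?theta_gt0//.
  by rewrite ler_pM2r ?invr_gt0// ler_pM2l// ler_nat leq_exp2l.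
rewrite -mulr_sumr.
have -> : 194 * (theta K)%:R * log_threshold K / eps ^+ 2 =
    97 * log_threshold K / eps ^+ 2 * (2 * (theta K)%:R).
  by field; rewrite gt_eqF.
rewrite ler_wpM2l// -natr_sum -natrM ler_nat.
elim: {c0 Kd} K => [|K IH]; first by rewrite big_nat1 mul2n -addnn leq_addl.
rewrite big_nat_recr//= (leq_trans (leq_add IH (leqnn _)))//.
by rewrite -expnS -/(theta K.+1) mul2n -addnn.
Qed.

End Concentrated.

End SampleSize.

(** * Concentration within one iteration *)

Lemma discrete_measurable_first_return {d} {T : measurableType d} {n : nat}
    (i : 'I_n) (th : nat) (Y : nat -> T -> 'I_n) :
  (forall t, discrete_measurable (Y t)) ->
  discrete_measurable (fun w => first_return i th (Y^~ w)).
Proof.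
move=> Ym.
have -> : (fun w => first_return i th (Y^~ w)) =
    (fun u => (find (pred1 i) u).+1) \o (fun w => [seq Y t.+1 w | t <- iota 0 th]).
  by apply/funext => w /=; rewrite find_map.
by apply: discrete_measurable_comp; apply: discrete_measurable_map => t _; exact: Ym.
Qed.

Section RandomSamples.
Context {R : realType} {n : nat} {d} {Omega : measurableType d}
  (Pr : probability Omega R).
Variables (P : 'M[R]_n) (i : 'I_n) (eps alpha : R)
  (X : nat -> nat -> nat -> Omega -> 'I_n).
Hypotheses (P_st : stochastic P) (eps01 : 0 < eps < 1) (alpha01 : 0 < alpha < 1).
Hypothesis X_P : forall k s, markov_chain_from Pr P i (X k s).
Hypothesis X_indep : mutually_independent Pr
  (fun ks : nat * nat => sigma_process (X ks.1 ks.2)).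

Let x w k s t := X k s t w.
Let tau (ks : nat * nat) w := first_return i (theta ks.1) (x w ks.1 ks.2).
Let N k w := sample_size i eps alpha (x w) k.
Let V (J : seq (nat * nat)) w := [seq tau j w | j <- J].

Let tau_m ks : discrete_measurable (tau ks).
Proof.
apply: discrete_measurable_first_return => t.
exact: (markov_chain_measurable (X_P ks.1 ks.2)).
Qed.

Let tau_indep (J : seq (nat * nat)) (l : nat * nat -> nat) : uniq J ->
  Pr (\big[setI/setT]_(j <- J) tau j @^-1` [set l j]) =
  (\prod_(j <- J) Pr (tau j @^-1` [set l j]))%E.
Proof.
move=> uJ; apply: X_indep => // j _.
pose G := [set A | exists t y, A = X j.1 j.2 t @^-1` [set y]].
apply: (@discrete_measurable_first_return _ (g_sigma_algebraType G)) => t.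
apply: discrete_measurableP => y; apply: sub_sigma_algebra.
by exists t, y.
Qed.

Let Vm J : discrete_measurable (V J).
Proof. by apply: discrete_measurable_map. Qed.

Let block (k m : nat) := [seq (k, s) | s <- iota 0 m].

Let sum_block (f : nat -> R) k m w :
  \sum_(s < m) f (tau (k, s : nat) w) = \sum_(l <- V (block k m) w) f l.
Proof.
rewrite /V /block !big_map -(big_mkord xpredT (fun s => f (tau (k, s) w))).
by rewrite /index_iota subn0.
Qed.

Let mean_lengthV k m w : mean_length i (x w) k m =
  m%:R^-1 * \sum_(l <- V (block k m) w) (minn l (theta k))%:R :> R.
Proof. by rewrite mean_lengthE (sum_block (fun l => (minn l (theta k))%:R)). Qed.

Let next_size k m (u : seq nat) : nat :=
  `|Num.ceil (3 * (1 + eps) * (theta k.+1)%:R * ln (4 * (theta k.+1)%:R / alpha)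
     / (m%:R^-1 * (\sum_(l <- u) (minn l (theta k))%:R) * eps ^+ 2))|%N.

Let N_S k w : N k.+1 w = next_size k (N k w) (V (block k (N k w)) w).
Proof. by rewrite /N /= mean_lengthV. Qed.

Let Nm k : discrete_measurable (N k).
Proof.
elim: k => [|k IH]; first exact: discrete_measurable_cst.
rewrite (_ : N k.+1 = fun w => next_size k (N k w) (V (block k (N k w)) w)).
  apply: (discrete_measurable_select (G := fun m w => next_size k m (V (block k m) w))) => // m.
  by apply: (discrete_measurable_comp (next_size k m)); exact: Vm.
by apply/funext => w; exact: N_S.
Qed.

(** Given N k = m', the event N k.+1 = m concerns the first m' samples of iteration k, which are
    disjoint from those in J. Allowing arbitrary finite J from iteration k on is what lets the
    induction absorb them. *)
Let sample_size_independent k m (J : seq (nat * nat)) (U : set (seq nat)) :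
  uniq J -> {in J, forall j, k <= j.1}%N ->
  Pr (N k @^-1` [set m] `&` V J @^-1` U) =
  (Pr (N k @^-1` [set m]) * Pr (V J @^-1` U))%E.
Proof.
elim: k m J U => [|k IH] m J U uJ kJ.
  (* The initial size reads no trajectory; a constant one stands in. *)
  have [Nm0|Nm0] := eqVneq (sample_size i eps alpha (fun _ _ _ => i) 0) m.
    rewrite (_ : N 0 @^-1` _ = setT) ?setTI ?probability_setT ?mul1e//.
    by rewrite -subTset => w _ /=; rewrite -Nm0.
  rewrite (_ : N 0 @^-1` _ = set0) ?set0I ?measure0 ?mul0e//.
  by rewrite -subset0 => w /= Nw; rewrite -Nw eqxx in Nm0.
pose C m' := V (block k m') @^-1` [set u | next_size k m' u = m].
have NC m' : N k @^-1` [set m'] `&` N k.+1 @^-1` [set m] = N k @^-1` [set m'] `&` C m'.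
  have Q w : N k w = m' -> (N k.+1 w = m) = (next_size k m' (V (block k m') w) = m).
    by move=> e; rewrite N_S e.
  by apply/seteqP; split=> w [Nk h]; split=> //; move: h; rewrite /C /preimage /mkset/= Q.
have uB m' : uniq (block k m').
  by rewrite map_inj_uniq ?iota_uniq// => s t [].
have kB m' : {in block k m', forall j, k <= j.1}%N.
  by move=> j /mapP[s _ ->]/=.
have -> : Pr (N k.+1 @^-1` [set m]) =
    (\sum_(0 <= m' <oo) Pr (N k @^-1` [set m']) * Pr (C m'))%E.
  rewrite (probability_total Pr (Nm k) (Nm k.+1 [set m])); apply: eq_eseriesr => m' _.
  by rewrite NC IH.
rewrite (probability_total Pr (Nm k)); last by apply: measurableI; [exact: Nm|exact: Vm].
have VJ : Pr (V J @^-1` U) \is a fin_num by rewrite fin_num_measure//; exact: Vm.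
rewrite muleC -(fineK VJ) -nneseriesZl//; last by move=> m' _; rewrite mule_ge0.
rewrite fineK//; apply: eq_eseriesr => m' _.
have uJB : uniq (block k m' ++ J).
  rewrite cat_uniq uB uJ andbT/=; apply/hasPn => j jJ; apply/negP => /mapP[s _ js].
  by have := kJ j jJ; rewrite js ltnn.
rewrite setIA NC -setIA.
(* Both events are merged into one about the concatenated list, to which the induction hypothesis
   applies. *)
have -> : C m' `&` V J @^-1` U = V (block k m' ++ J) @^-1`
    [set u | next_size k m' (take m' u) = m /\ U (drop m' u)].
  apply/seteqP; split=> w /=; rewrite /C/= /V map_cat -/(V _ w) -/(V _ w).
    by rewrite take_size_cat ?drop_size_cat ?size_map ?size_iota.
  by rewrite take_size_cat ?drop_size_cat ?size_map ?size_iota.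
rewrite IH//; last first.
  by move=> j; rewrite mem_cat => /orP[/kB//|/kJ /ltnW].
rewrite muleCA; congr (_ * _)%E; rewrite muleC.
rewrite -(independent_blocks tau_m tau_indep)//; congr (Pr _).
apply/seteqP; split=> w /=; rewrite /C/= /V map_cat -/(V _ w) -/(V _ w).
  by rewrite take_size_cat ?drop_size_cat ?size_map ?size_iota.
by rewrite take_size_cat ?drop_size_cat ?size_map ?size_iota.
Qed.

(** Conditioning on N k = m leaves the samples independent with their original law, so the Chernoff
    bound for fixed m applies; being uniform over S, it survives averaging over m. *)
Lemma sample_sum_tail k (S : set nat) (a : nat -> R) (psi : nat -> R) (M b : R) :
  0 <= b ->
  (forall s, \sum_(l < (theta k).+2) law Pr (tau (k, s)) l * expR (psi l) <= M) ->
  (forall m, S m -> expR (- a m) * M ^+ m <= b) ->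
  (Pr [set w | S (N k w) /\
    (a (N k w) <= \sum_(s < N k w) psi (tau (k, s : nat) w))%R] <= b%:E)%E.
Proof.
move=> b0 mgf aS.
pose D m := V (block k m) @^-1` [set u | (a m <= \sum_(l <- u) psi l)%R].
pose E := [set w | S (N k w) /\ D (N k w) w].
have Em : measurable E.
  apply: (discrete_measurable_select (G := fun m w => S m /\ D m w) (Nm k) _
    [set Q : Prop | Q]) => m.
  by apply: (discrete_measurable_comp (fun u => S m /\ (a m <= \sum_(l <- u) psi l)%R)); exact: Vm.
have -> : [set w | S (N k w) /\
    (a (N k w) <= \sum_(s < N k w) psi (tau (k, s : nat) w))%R] = E.
  by apply: eq_set => w; rewrite sum_block.
rewrite (probability_total Pr (Nm k) Em).
have D_le m : S m -> (Pr (D m) <= b%:E)%E.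
  move=> Sm; apply: (@le_trans _ _ (expR (- a m) * M ^+ m)%:E); last by rewrite lee_fin aS.
  have -> : D m = [set w | (a m <= \sum_(s < m) psi (tau (k, s : nat) w))%R].
    by apply: eq_set => w; rewrite sum_block.
  apply: (chernoff (tau := fun s => tau (k, s)) (b := (theta k).+2)) => //.
  - by move=> s w; rewrite ltnS first_return_le.
  - move=> m' U l /=.
    have := @independent_blocks _ _ _ Pr _ _ tau_m tau_indep
      (block k m') [:: (k, m')] U [set [:: l]].
    rewrite cats1 rcons_uniq map_inj_uniq ?iota_uniq; last by move=> s t [].
    have -> : (k, m') \notin block k m'.
      apply/negP => /mapP[s]; rewrite mem_iota add0n => /andP[_ sm] [e].
      by rewrite e ltnn in sm.
    move=> /(_ isT); rewrite (_ : (fun w => [seq tau j w | j <- [:: (k, m')]]) @^-1` _ =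
      tau (k, m') @^-1` [set l]); last first.
      by apply/seteqP; split=> w /= => [[]|->].
    rewrite (_ : (fun w => [seq tau j w | j <- block k m']) =
      (fun w => [seq tau (k, s) w | s <- iota 0 m']))//.
    by apply/funext => w; rewrite -map_comp.
apply: (@le_trans _ _ (\sum_(0 <= m <oo) b%:E * Pr (N k @^-1` [set m])))%E.
  apply: lee_nneseries => // m _.
  have [Sm|nSm] := pselect (S m).
    have -> : N k @^-1` [set m] `&` E = N k @^-1` [set m] `&` D m.
      apply/seteqP; split=> w [Nk h]; (split; first by []); have e : N k w = m := Nk.
        by case: h => _; rewrite e.
      by split; rewrite e.
    rewrite sample_size_independent; last 2 first.
    - by rewrite map_inj_uniq ?iota_uniq// => s t [].
    - by move=> j /mapP[s _ ->]/=.
    by rewrite muleC lee_wpmul2r// D_le.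
  rewrite (_ : _ `&` _ = set0) ?measure0 ?mule_ge0//.
  rewrite -subset0 => w [Nk [+ _]]; have e : N k w = m := Nk.
  by rewrite e.
rewrite nneseriesZl//.
have := probability_total Pr (Nm k) measurableT.
rewrite probability_setT (eq_eseriesr (fun m _ => _ : _ = Pr (N k @^-1` [set m]))) => [<-|m _].
  by rewrite mule1.
by rewrite setIT.
Qed.

(** Everything iteration k reveals: That and phat are functions of this discrete value. *)
Let stage k w := (N k w, V (block k (N k w)) w).

Let stage_m k : discrete_measurable (stage k).
Proof.
apply: (discrete_measurable_select (G := fun m w => (m, V (block k m) w)) (Nm k)) => m.
by apply: (discrete_measurable_comp (pair m)); exact: Vm.
Qed.

Let stage_That k (u : nat * seq nat) : R :=
  u.1%:R^-1 * \sum_(l <- u.2) (minn l (theta k))%:R.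

Let stage_phat k (u : nat * seq nat) : R :=
  u.1%:R^-1 * \sum_(l <- u.2) (theta k < l)%N%:R.

Let That_stage k w : That i eps alpha (x w) k = stage_That k (stage k w).
Proof. exact: mean_lengthV. Qed.

Let phat_stage k w : phat i eps alpha (x w) k = stage_phat k (stage k w).
Proof. by rewrite phatE (sum_block (fun l => (theta k < l)%N%:R)). Qed.

Lemma measurable_stage k (Q : nat -> R -> R -> Prop) :
  measurable [set w | Q (N k w) (That i eps alpha (x w) k) (phat i eps alpha (x w) k)].
Proof.
rewrite (_ : [set _ | _] = stage k @^-1`
    [set u | Q u.1 (stage_That k u) (stage_phat k u)]); first exact: stage_m.
by apply: eq_set => w; rewrite That_stage phat_stage.
Qed.

Lemma measurable_total_steps delta (B : \bar R) :
  measurable [set w | (total_steps i eps alpha (x w) delta <= B)%E].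
Proof.
have NT0 w k : (0 <=
    ((sample_size i eps alpha (x w) k)%:R * That i eps alpha (x w) k)%:E)%E.
  rewrite lee_fin mulr_ge0 ?ler0n//.
  by have := @That_ge1 _ _ i (x w) _ _ eps01 alpha01 k; lra.
pose part K w := (\sum_(0 <= k < K |
    all (fun j => (delta <= phat i eps alpha (x w) j)%R) (iota 0 k))
  ((sample_size i eps alpha (x w) k)%:R * That i eps alpha (x w) k)%:E)%E.
rewrite (_ : [set _ | _] = \bigcap_K [set w | (part K w <= B)%E]); last first.
  apply/seteqP; split=> w /= h.
    by move=> K _ /=; apply: le_trans h; apply: nneseries_lim_ge.
  apply: lime_le; first by apply: is_cvg_nneseries_cond => k _ _; exact: NT0.
  by apply: nearW => K; exact: (h K).
apply: bigcapT_measurable => K.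
pose hist w := [seq stage k w | k <- iota 0 K].
have hist_m : discrete_measurable hist by apply: discrete_measurable_map.
pose nt (h : seq (nat * seq nat)) k := nth (0%N, [::]) h k.
rewrite (_ : [set _ | _] = hist @^-1` [set h |
  (\sum_(0 <= k < K | all (fun j => (delta <= stage_phat j (nt h j))%R) (iota 0 k))
  ((nt h k).1%:R * stage_That k (nt h k))%:E <= B)%E]); first exact: hist_m.
have ntE w k : (k < K)%N -> nt (hist w) k = stage k w.
  by move=> kK; rewrite /nt (nth_map 0%N) ?size_iota// nth_iota.
apply: eq_set => w; congr ((_ <= B)%E : Prop).
rewrite /part big_nat_cond [RHS]big_nat_cond; apply: eq_big => [k|k /andP[/andP[_ kK] _]].
  have [kK|] := ltnP k K; last by rewrite andbF.
  congr (_ && _); apply/eq_in_all => j; rewrite mem_iota add0n => /andP[_ jk].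
  by rewrite phat_stage ntE// (ltn_trans jk).
by rewrite That_stage ntE.
Qed.

Let mu k : R := \sum_(t < theta k) survival P i t i.
Let p k : R := survival P i (theta k) i.

Let tau_b k s w : (tau (k, s) w < (theta k).+2)%N.
Proof. by rewrite ltnS first_return_le. Qed.

Let tau_gt k s t : (t <= theta k)%N ->
  Pr [set w | (t < tau (k, s) w)%N] = (survival P i t i)%:E.
Proof.
move=> tk; rewrite -(survival_probability i (X_P k s)); congr (Pr _).
by apply/seteqP; split=> w /= /first_return_gtP; apply.
Qed.

Let law_gt k s t : (t <= theta k)%N ->
  \sum_(l < (theta k).+2) law Pr (tau (k, s)) l * (t < l)%N%:R = survival P i t i.
Proof.
move=> tk; apply: EFin_inj; rewrite -(tau_gt s tk).
exact: (sum_law Pr (tau_b k s) (tau_m (k, s)) (fun l => (t < l)%N)).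
Qed.

Let law_mean k s :
  \sum_(l < (theta k).+2) law Pr (tau (k, s)) l * ((minn l (theta k))%:R / (theta k)%:R) =
  mu k / (theta k)%:R.
Proof.
under eq_bigr do rewrite mulrA; rewrite -mulr_suml; congr (_ / _).
have minnE l m : minn l m = (\sum_(t < m) (t < l))%N.
  elim: m => [|m IH]; first by rewrite big_ord0 minn0.
  by rewrite big_ord_recr/= -IH; lia.
under eq_bigr do rewrite minnE natr_sum mulr_sumr.
by rewrite exchange_big/=; apply: eq_bigr => t _; rewrite law_gt// ltnW.
Qed.

Let sum_lengths k w : \sum_(s < N k w) (minn (tau (k, s : nat) w) (theta k))%:R =
  (N k w)%:R * That i eps alpha (x w) k :> R.
Proof.
rewrite /That mean_lengthE mulrA mulfV ?mul1r// pnatr_eq0 -lt0n.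
exact: sample_size_gt0.
Qed.

Let sum_truncated k w : \sum_(s < N k w) (theta k < tau (k, s : nat) w)%N%:R =
  (N k w)%:R * phat i eps alpha (x w) k :> R.
Proof.
rewrite phatE mulrA mulfV ?mul1r// pnatr_eq0 -lt0n.
exact: sample_size_gt0.
Qed.

Let th0 k : 0 < (theta k)%:R :> R. Proof. by rewrite ltr0n theta_gt0. Qed.

(** Both tails at once, as a negative c reverses the inequality. Lengths are divided by theta to lie
    in [0, 1], and the Chernoff exponent is m mu / theta times exp c - 1 - c r. *)
Lemma mean_length_tail c r k : expR c - 1 - c * r <= - (eps ^+ 2 / 3) ->
  (Pr [set w | large_sample eps alpha mu k (N k w) /\
    (c * (r * ((N k w)%:R * mu k)) <= c * ((N k w)%:R * That i eps alpha (x w) k))%R]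
  <= (alpha / 4 / (theta k)%:R)%:E)%E.
Proof.
move=> cr; have /andP[a0 a1] := alpha01.
pose psi l : R := c * ((minn l (theta k))%:R / (theta k)%:R).
pose a m := c * (r * (m%:R * mu k)) / (theta k)%:R.
rewrite (_ : [set _ | _] = [set w | large_sample eps alpha mu k (N k w) /\
    (a (N k w) <= \sum_(s < N k w) psi (tau (k, s : nat) w))%R]); last first.
  apply: eq_set => w; congr (_ /\ (_ : bool)).
  rewrite -mulr_sumr -mulr_suml sum_lengths /a [X in _ = (_ <= X)]mulrA.
  by rewrite ler_pM2r ?invr_gt0.
apply: (@sample_sum_tail k [set m | large_sample eps alpha mu k m] a psi
  (expR ((expR c - 1) * (mu k / (theta k)%:R))) _).
- by rewrite !divr_ge0// ltW.
- move=> s; rewrite -(law_mean k s).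
  apply: (mgf_le Pr (tau_b k s) (tau_m _)
    (phi := fun l => (minn l (theta k))%:R / (theta k)%:R)) => l.
  by rewrite divr_ge0// ler_pdivrMr// mul1r ler_nat geq_minr.
move=> m /= large; rewrite -expRM_natl -expRD -(expR_log_threshold alpha01) ler_expR.
rewrite /large_sample in large.
have -> : - a m + m%:R * ((expR c - 1) * (mu k / (theta k)%:R)) =
    (m%:R * mu k) * (expR c - 1 - c * r) / (theta k)%:R by rewrite /a; ring.
rewrite ler_pdivrMr//.
have m0 : 0 <= m%:R * mu k by rewrite mulr_ge0// sumr_ge0// => t _; rewrite survival_ge0.
have := ler_wpM2l m0 cr; lra.
Qed.

(** The deviation is additive because p may be tiny; it enters the error as 2 Zmax(i) eps / 3. With
    exponent parameter eps, the sample size suffices if 6 (1 + eps) (1/3 - (1 + eps) / 8) >= 1, an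
    equality at eps = 1. *)
Lemma truncated_additive_tail k :
  (Pr [set w | (phat i eps alpha (x w) k + eps / 3 <= p k)%R]
  <= (alpha / 4 / (theta k)%:R)%:E)%E.
Proof.
have /andP[a0 a1] := alpha01; have /andP[e0 e1] := eps01.
pose psi l : R := eps * (p k - (theta k < l)%N%:R).
pose a m : R := eps * (m%:R * (eps / 3)).
pose S m := 6 * (1 + eps) * log_threshold alpha k <= m%:R * eps ^+ 2.
rewrite (_ : [set _ | _] = [set w | S (N k w) /\
    (a (N k w) <= \sum_(s < N k w) psi (tau (k, s : nat) w))%R]); last first.
  have aE w : (a (N k w) <= \sum_(s < N k w) psi (tau (k, s : nat) w))%R =
      (phat i eps alpha (x w) k + eps / 3 <= p k)%R.
    rewrite -mulr_sumr sumrB sum_truncated sumr_const card_ord -[p k *+ _]mulr_natl -mulrBr.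
    rewrite /a ler_pM2l// ler_pM2l ?ltr0n ?sample_size_gt0//.
    by rewrite lerBrDl.
  apply/seteqP; split=> w /=; rewrite aE; last by case.
  by move=> h; split=> //; exact: sample_size_ge.
apply: (@sample_sum_tail k [set m | S m] a psi (expR (eps ^+ 2 * (1 + eps) / 8)) _).
- by rewrite !divr_ge0// ltW.
- move=> s; apply: (mgf_bernoulli_le (Pr := Pr) (tau_b k s) (tau_m _)
    (U := fun l => (theta k < l)%N)).
    exact: tau_gt.
  by rewrite !ltW.
move=> m /= Sm; rewrite -expRM_natl -expRD -(expR_log_threshold alpha01) ler_expR.
have -> : - a m + m%:R * (eps ^+ 2 * (1 + eps) / 8) =
    - (m%:R * eps ^+ 2 * (1 / 3 - (1 + eps) / 8)) by rewrite /a; field.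
rewrite lerN2; have c0 : 0 <= 1 / 3 - (1 + eps) / 8 by lra.
apply: le_trans (ler_wpM2r c0 Sm).
have L0 := log_threshold_gt1 alpha01 k.
rewrite mulrAC -[leLHS]mul1r ler_wpM2r//; first by lra.
have : 0 <= eps * (1 - eps) by rewrite mulr_ge0//; lra.
lra.
Qed.

Lemma truncated_tail k c (S : set nat) (a : nat -> R) b : 0 <= b ->
  (forall m, S m -> expR (- (c * a m) + (expR c - 1) * (p k * m%:R)) <= b) ->
  (Pr [set w | S (N k w) /\
    (c * a (N k w) <= c * ((N k w)%:R * phat i eps alpha (x w) k))%R] <= b%:E)%E.
Proof.
move=> b0 Sb.
pose psi l : R := c * (theta k < l)%N%:R.
rewrite (_ : [set _ | _] = [set w | S (N k w) /\
    (c * a (N k w) <= \sum_(s < N k w) psi (tau (k, s : nat) w))%R]); last first.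
  by apply: eq_set => w; rewrite -mulr_sumr sum_truncated.
apply: (@sample_sum_tail k S (fun m => c * a m) psi (expR ((expR c - 1) * p k)) b b0).
  move=> s; rewrite -[p k](law_gt s (leqnn (theta k))).
  apply: (mgf_le Pr (tau_b k s) (tau_m _) (phi := fun l => (theta k < l)%N%:R)) => l.
  by rewrite ler0n lern1 leq_b1.
move=> m Sm; rewrite -expRM_natl -expRD.
by apply: le_trans (Sb m Sm); rewrite ler_expR lerD2l mulrCA [m%:R * _]mulrC.
Qed.

End RandomSamples.

(** * Concentration over all iterations *)

(** Union bound, with 1 / theta k = 2^-(k+1) summing to 1. *)
Lemma probability_ge_of_bad {R : realType} {d} {T : measurableType d}
    (Pr : probability T R) (bad : nat -> set T) (F E : set T) (c f : R) :
  0 <= c -> (forall k, measurable (bad k)) -> measurable F -> measurable E ->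
  (forall k, (Pr (bad k) <= (c / (theta k)%:R)%:E)%E) -> (Pr F <= f%:E)%E ->
  (forall w, ~ F w -> (forall k, ~ bad k w) -> E w) ->
  ((1 - (c + f))%:E <= Pr E)%E.
Proof.
move=> c0 bm Fm Em bc Ff FbE.
have Um : measurable (\bigcup_k bad k) by exact: bigcupT_measurable.
have Uc : (Pr (\bigcup_k bad k) <= c%:E)%E.
  apply: le_trans (generalized_Boole_inequality _ bm Um) _.
  apply: le_trans (epsilon_trick0 xpredT c0); apply: lee_nneseries => // k _; exact: bc.
have Ec : (Pr (~` E) <= (c + f)%:E)%E.
  apply: (@le_trans _ _ (Pr (\bigcup_k bad k `|` F))).
    apply: le_measure; rewrite ?inE; [exact: measurableC|exact: measurableU|].
    move=> w nE; apply: contrapT => /not_orP[nU nF]; apply: nE; apply: FbE => // k bk.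
    by apply: nU; exists k.
  apply: le_trans (measureU2 _ _ _) _ => //.
  by rewrite EFinD leeD.
move: Ec; rewrite probability_setC// -(fineK (fin_num_measure Pr E Em)).
by rewrite -EFinB !lee_fin; lra.
Qed.

(** * Lower bounds on the mixing time and products of soft-O terms *)

Section TmixTheory.
Context {R : realType} {n : nat} (P : 'M[R]_n) (pi : 'rV[R]_n).

Lemma tmix_ge (c : R) :
  (forall T : nat, (0 < T)%N ->
     \big[Num.max/0]_(x < n) TV (row x (P ^+ T)) pi <= 4^-1 -> c <= T%:R) ->
  (c%:E <= tmix P pi)%E.
Proof.
by move=> h; apply: le_ereal_inf_tmp => _ [T [T0 TV4] <-]; rewrite lee_fin h.
Qed.

Lemma tmix_ge1 : (1 <= tmix P pi)%E.
Proof. by apply: tmix_ge => T T0 _; rewrite ler1n. Qed.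

End TmixTheory.

Lemma softO_fin {R : realType} (r : R) : 0 <= r ->
  softO 1 r%:E = (r * (1 + ln (1 + r)))%:E.
Proof.
move=> r0; have r1 : (1 + r <= 0) = false by apply/negbTE; rewrite -ltNge; lra.
by rewrite /softO /expe/= r1.
Qed.

Lemma ln1D_ge0 {R : realType} (r : R) : 0 <= r -> 0 <= ln (1 + r).
Proof. by move=> r0; rewrite ln_ge0//; lra. Qed.

(** Since 1 + c t y <= (1 + c) (1 + t) (1 + y), the logarithms add up, and one plus their sum is at
    most the product of the factors 1 + ln. *)
Lemma softO_scale {R : realType} (c h t y : R) :
  0 <= c -> 0 <= h -> 0 <= t -> 0 <= y -> h <= c * t * y ->
  h * (1 + ln (1 + h)) <=
  c * (1 + ln (1 + c)) * (t * (1 + ln (1 + t))) * (y * (1 + ln (1 + y))).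
Proof.
move=> c0 h0 t0 y0 hcty.
have := ln1D_ge0 c0; have := ln1D_ge0 t0; have := ln1D_ge0 y0; have hh := ln1D_ge0 h0.
have : ln (1 + h) <= ln (1 + c) + ln (1 + t) + ln (1 + y).
  rewrite -!lnM ?posrE ?mulr_gt0//; try lra.
  rewrite ler_ln ?posrE ?mulr_gt0//; try lra.
  have := mulr_ge0 c0 t0; have := mulr_ge0 c0 y0; have := mulr_ge0 t0 y0; lra.
set a := ln (1 + c); set b := ln (1 + t); set d := ln (1 + y) => le d0 b0 a0.
have -> : c * (1 + a) * (t * (1 + b)) * (y * (1 + d)) =
  (c * t * y) * ((1 + a) * (1 + b) * (1 + d)) by ring.
apply: ler_pM => //; first by lra.
apply: (@le_trans _ _ (1 + a + b + d)); first by lra.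
have := mulr_ge0 a0 b0; have := mulr_ge0 a0 d0; have := mulr_ge0 b0 d0.
have := mulr_ge0 (mulr_ge0 a0 b0) d0; lra.
Qed.

Section Concentration.
Context {R : realType} {n : nat} {d} {Omega : measurableType d}
  (Pr : probability Omega R).
Variables (P : 'M[R]_n) (pi : 'rV[R]_n) (i : 'I_n) (eps alpha : R)
  (X : nat -> nat -> nat -> Omega -> 'I_n).
Hypotheses (P_st : stochastic P) (P_irr : irreducible P)
  (P_pi : stationary P pi).
Hypotheses (eps01 : 0 < eps < 1) (alpha01 : 0 < alpha < 1).
Hypothesis X_P : forall k s, markov_chain_from Pr P i (X k s).
Hypothesis X_indep : mutually_independent Pr
  (fun ks : nat * nat => sigma_process (X ks.1 ks.2)).

Let x w k s t := X k s t w.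
Let N w k := sample_size i eps alpha (x w) k.
Let T w k := That i eps alpha (x w) k.
Let ph w k := phat i eps alpha (x w) k.
Let mu k : R := \sum_(t < theta k) survival P i t i.
Let p k : R := survival P i (theta k) i.

Let mu_ge1 k : 1 <= mu k.
Proof.
rewrite /mu -(prednK (theta_gt0 k)) big_ord_recl survival0 lerDl.
by rewrite sumr_ge0// => t _; rewrite survival_ge0.
Qed.

Let muE k : mu k = \sum_(0 <= t < theta k) survival P i t i.
Proof. by rewrite big_mkord. Qed.

Let thetaS k : theta k.+1 = (theta k + theta k)%N.
Proof. by rewrite /theta expnS mul2n addnn. Qed.

Let mu_homo k : mu k <= mu k.+1.
Proof.
rewrite !muE thetaS (big_cat_nat (leq0n _) (leq_addr (theta k) (theta k)))/= lerDl.
by rewrite sumr_ge0// => t _; rewrite survival_ge0.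
Qed.

Let mu_double k : mu k.+1 <= 2 * mu k.
Proof.
rewrite !muE thetaS (big_cat_nat (leq0n _) (leq_addr (theta k) (theta k)))/=.
rewrite mulr_natl mulr2n lerD2l -{1}[theta k]add0n big_addn addnK.
by apply: ler_sum => t _; apply: survival_homo => //; exact: leq_addr.
Qed.

Let length_bad c r k : set Omega :=
  [set w | large_sample eps alpha mu k (N w k) /\
    c * (r * ((N w k)%:R * mu k)) <= c * ((N w k)%:R * T w k)].

Let length_badm c r k : measurable (length_bad c r k).
Proof.
exact: (measurable_stage eps alpha X_P k (fun m t _ => large_sample eps alpha mu k m /\
    c * (r * (m%:R * mu k)) <= c * (m%:R * t))).
Qed.

Let length_bad_le c r k : expR c - 1 - c * r <= - (eps ^+ 2 / 3) ->
  (Pr (length_bad c r k) <= (alpha / 4 / (theta k)%:R)%:E)%E.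
Proof. exact: mean_length_tail. Qed.

(** Solves (2 + c) / (2 - c) = 1 + eps: a rational substitute for the optimal parameter ln (1 +
    eps). *)
Let upper_c : R := 2 * eps / (2 + eps).

Let upper_cond : expR upper_c - 1 - upper_c * (1 + eps) <= - (eps ^+ 2 / 3).
Proof.
have /andP[e0 e1] := eps01; have e2 : 0 < 2 + eps by lra.
have c0 : 0 <= upper_c by rewrite divr_ge0//; lra.
have cE : upper_c * (2 + eps) = 2 * eps by rewrite divfK// gt_eqF.
have ec : expR upper_c <= 1 + eps.
  have := expR_le_pade c0; rewrite -(ler_pM2r e2) mulrAC.
  have -> : (2 - upper_c) * (2 + eps) = 4 by lra.
  lra.
have : eps ^+ 2 / 3 <= upper_c * (1 + eps) - eps.
  rewrite -(ler_pM2r e2).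
  have -> : (upper_c * (1 + eps) - eps) * (2 + eps) =
    upper_c * (2 + eps) * (1 + eps) - eps * (2 + eps) by ring.
  rewrite cE; have := ler_wpM2l (exprn_ge0 2 (ltW e0)) (ltW e1); lra.
lra.
Qed.

Let lower_cond : expR (- eps) - 1 - (- eps) * (1 - eps) <= - (eps ^+ 2 / 3).
Proof.
have /andP[e0 e1] := eps01; have := expRN_le (ltW e0); have := sqr_ge0 eps; lra.
Qed.

(** The lower bound (1 - eps) mu degenerates as eps tends to 1, whereas the step count needs a
    fraction of mu independent of eps. *)
Let quarter_cond : expR (- 1) - 1 - (- 1) * (1 / 4) <= - (eps ^+ 2 / 3).
Proof.
have /andP[e0 e1] := eps01.
have e2 : eps ^+ 2 <= 1 by rewrite expr_le1// ltW.
have h := @expRN_le R (1 / 2) ltac:(lra).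
have h2 : expR (- (1 / 2) : R) ^+ 2 <= (5 / 8) ^+ 2.
  by rewrite lerXn2r ?nnegrE ?expR_ge0//; lra.
have -> : - 1 = 2%:R * - (1 / 2) :> R by field.
rewrite expRM_natl; lra.
Qed.

Let length_good c r k w : ~ length_bad c r k w ->
  large_sample eps alpha mu k (N w k) -> c * T w k < c * (r * mu k).
Proof.
move=> /not_andP[//|+ _] => /negP; rewrite -ltNge => h.
have N0 : 0 < (N w k)%:R :> R by rewrite ltr0n; exact: sample_size_gt0.
by rewrite -(ltr_pM2l N0); lra.
Qed.

Let upper_good k w : ~ length_bad upper_c (1 + eps) k w ->
  large_sample eps alpha mu k (N w k) -> T w k <= (1 + eps) * mu k.
Proof.
have /andP[e0 e1] := eps01.
move=> b l; have := length_good b l; rewrite ltr_pM2l; first exact: ltW.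
by rewrite divr_gt0//; lra.
Qed.

Let lower_good k w : ~ length_bad (- eps) (1 - eps) k w ->
  large_sample eps alpha mu k (N w k) -> (1 - eps) * mu k <= T w k.
Proof.
have /andP[e0 e1] := eps01.
move=> b l; have := length_good b l; rewrite !mulNr ltrN2 ltr_pM2l//; exact: ltW.
Qed.

Let quarter_good k w : ~ length_bad (- 1) (1 / 4) k w ->
  large_sample eps alpha mu k (N w k) -> mu k / 4 <= T w k.
Proof. by move=> b l; have := length_good b l; lra. Qed.

(** The relative error equals 1 - pi_i That, linear in That. Overestimation costs eps since pi_i mu
    <= 1; underestimation adds the truncation bias 2 Zmax(i) p, with p < delta + eps / 3. *)
Lemma error_bound (Z : 'M[R]_n) delta w k :
  (forall y, Z y i - \sum_z P y z * Z z i = (y == i)%:R - pi 0 i) ->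
  (1 - eps) * mu k <= T w k <= (1 + eps) * mu k ->
  p k <= ph w k + eps / 3 -> ph w k < delta ->
  `|(pihat i eps alpha (x w) k - pi 0 i) / pihat i eps alpha (x w) k| <=
    eps * (1 + 2 / 3 * Zmax Z i) + 2 * delta * Zmax Z i.
Proof.
have /andP[e0 e1] := eps01.
move=> poisson /andP[Tl Tu] pk pd.
have /andP[b0 b1] := truncated_bias P_st P_irr P_pi poisson (theta_gt0 k).
have Z0 : 0 <= Zmax Z i by apply: le_trans (le_bigmax _ (fun k => `|Z k i|) i).
have pi0 := stationary_gt0 P_st P_irr P_pi i.
have T0 : 0 < T w k.
  by have := @That_ge1 _ _ i (x w) _ _ eps01 alpha01 k; rewrite -/(T w k); lra.
have -> : (pihat i eps alpha (x w) k - pi 0 i) / pihat i eps alpha (x w) k = 1 - pi 0 i * T w k.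
  by rewrite /pihat -/(T w k) invrK mulrBl mulVf// gt_eqF.
rewrite -/(mu k) -/(p k) in b0 b1.
have pTu := ler_wpM2l (ltW pi0) Tu; have pTl := ler_wpM2l (ltW pi0) Tl.
have h1 : eps * (pi 0 i * mu k) <= eps * 1 by rewrite ler_pM2l//; lra.
have h2 : Zmax Z i * p k <= Zmax Z i * (delta + eps / 3) by rewrite ler_wpM2l//; lra.
rewrite ler_norml; apply/andP; split; lra.
Qed.

Lemma estimate_probability (E : set Omega) delta : measurable E ->
  (forall w, (forall k, ph w k < delta ->
     (1 - eps) * mu k <= T w k <= (1 + eps) * mu k /\ p k <= ph w k + eps / 3) -> E w) ->
  ((1 - alpha)%:E < Pr E)%E.
Proof.
have /andP[a0 a1] := alpha01.
move=> Em h.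
pose add_bad k := [set w | ph w k + eps / 3 <= p k].
have add_badm k : measurable (add_bad k).
  exact: (measurable_stage eps alpha X_P k (fun _ _ q => q + eps / 3 <= p k)).
pose bad k := length_bad upper_c (1 + eps) k `|` (length_bad (- eps) (1 - eps) k `|` add_bad k).
apply: (@lt_le_trans _ _ (1 - (3 / 4 * alpha + 0))%:E); first by rewrite lte_fin; lra.
apply: (@probability_ge_of_bad _ _ _ Pr bad set0 E) => //.
- by rewrite mulr_ge0//; lra.
- by move=> k; apply: measurableU => //; apply: measurableU.
- move=> k; apply: le_trans (measureU2 _ _ _) _ => //; first exact: measurableU.
  have -> : 3 / 4 * alpha / (theta k)%:R = alpha / 4 / (theta k)%:R
    + (alpha / 4 / (theta k)%:R + alpha / 4 / (theta k)%:R) by ring.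
  rewrite EFinD leeD ?length_bad_le//.
  apply: le_trans (measureU2 _ _ _) _ => //.
  by rewrite EFinD leeD ?length_bad_le//; exact: truncated_additive_tail.
- by rewrite measure0.
move=> w _ nbad; apply: h => k _.
have nb j : [/\ ~ length_bad upper_c (1 + eps) j w,
    ~ length_bad (- eps) (1 - eps) j w & ~ add_bad j w].
  by have /not_orP[? /not_orP[? ?]] := nbad j.
have large : forall j, large_sample eps alpha mu j (N w j).
  apply: large_sampleP => // j; by have [b _ _] := nb j; exact: upper_good.
have [b1 b2 /negP b3] := nb k.
split; first by rewrite lower_good// upper_good.
by move: b3; rewrite -ltNge => /ltW.
Qed.

Lemma steps_probability (F : set Omega) (f delta : R) (K : nat) (B : \bar R) :
  measurable F -> (Pr F <= f%:E)%E -> f < alpha / 2 ->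
  (forall w, ~ F w -> large_sample eps alpha mu K (N w K) -> ph w K < delta) ->
  ((194 * (theta K)%:R * log_threshold alpha K / eps ^+ 2)%:E <= B)%E ->
  ((1 - alpha)%:E < Pr [set w | (total_steps i eps alpha (x w) delta <= B)%E])%E.
Proof.
have /andP[a0 a1] := alpha01.
move=> Fm Ff fa FK KB.
pose bad k := length_bad upper_c (1 + eps) k `|` length_bad (- 1) (1 / 4) k.
apply: (@lt_le_trans _ _ (1 - (1 / 2 * alpha + f))%:E); first by rewrite lte_fin; lra.
apply: (@probability_ge_of_bad _ _ _ Pr bad F) => //.
- by rewrite mulr_ge0//; lra.
- by move=> k; apply: measurableU.
- exact: (measurable_total_steps eps01 alpha01 X_P).
- move=> k; apply: le_trans (measureU2 _ _ _) _ => //.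
  have -> : 1 / 2 * alpha / (theta k)%:R = alpha / 4 / (theta k)%:R
    + alpha / 4 / (theta k)%:R by field; rewrite pnatr_eq0 -lt0n theta_gt0.
  by rewrite EFinD leeD ?length_bad_le.
move=> w nF nbad /=; apply: le_trans KB.
have nb j : ~ length_bad upper_c (1 + eps) j w /\ ~ length_bad (- 1) (1 / 4) j w.
  by have /not_orP[? ?] := nbad j.
have large : forall j, large_sample eps alpha mu j (N w j).
  by apply: large_sampleP => // j; have [b _] := nb j; exact: upper_good.
apply: (@total_steps_le _ _ i (x w) _ _ eps01 alpha01 mu) => //; last exact: FK.
move=> k; have [b1 b2] := nb k.
by rewrite quarter_good//= upper_good.
Qed.

(** With c = ln (8 / alpha), the moment term is at most (8 / alpha) p m <= delta m <= a(m), so the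
    exponent is at most (1 - c) a(m) <= 1 - c, and exp (1 - c) <= 3 alpha / 8. *)
Lemma stop_rare delta K : 0 < delta -> p K <= alpha * delta / 8 ->
  (Pr [set w | (delta <= ph w K)%R] <= (3 / 8 * alpha)%:E)%E.
Proof.
have /andP[a0 a1] := alpha01; move=> d0 pK.
(* A positive number of truncated samples is at least 1: hence the maximum. *)
pose c := ln (8 / alpha); pose a m : R := Num.max 1 (delta * m%:R).
have c1 : 1 <= c by rewrite /c log_threshold0 ltW// log_threshold_gt1.
have ec : expR c = 8 / alpha by rewrite lnK// posrE divr_gt0.
rewrite (_ : [set _ | _] = [set w | setT (N w K) /\
    (c * a (N w K) <= c * ((N w K)%:R * ph w K))%R]); last first.
  have N0 w : 0 < (N w K)%:R :> R by rewrite ltr0n; exact: sample_size_gt0.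
  apply/seteqP; split=> w /=; rewrite ler_pM2l; try lra.
    move=> dp; split=> //; rewrite /a ge_max [delta * _]mulrC ler_pM2l// dp andbT.
    have : 0 < (N w K)%:R * ph w K by rewrite mulr_gt0//; lra.
    rewrite /ph phatE mulrA mulfV ?gt_eqF// mul1r -natr_sum ltr0n ler1n//.
  by move=> [_]; rewrite /a ge_max [delta * _]mulrC => /andP[_]; rewrite ler_pM2l.
apply: (truncated_tail eps01 alpha01 X_P X_indep) => [|m _]; first by rewrite mulr_ge0//; lra.
have am1 : 1 <= a m by rewrite le_max lexx.
have am2 : delta * m%:R <= a m by rewrite le_max lexx orbT.
have pm : (expR c - 1) * (p K * m%:R) <= a m.
  apply: le_trans am2; have m0 : 0 <= m%:R :> R by [].
  have p0 : 0 <= p K * m%:R by rewrite mulr_ge0// survival_ge0.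
  have := ler_wpM2r m0 pK; rewrite ec.
  have : 8 / alpha * (p K * m%:R) <= 8 / alpha * (alpha * delta / 8 * m%:R).
    by rewrite ler_wpM2l ?divr_ge0 ?ler_wpM2r//; lra.
  have -> : 8 / alpha * (alpha * delta / 8 * m%:R) = delta * m%:R by field; rewrite gt_eqF.
  lra.
apply: (@le_trans _ _ (expR (1 - c))).
  rewrite ler_expR -/(p K).
  have : 0 <= (c - 1) * (a m - 1) by rewrite mulr_ge0//; lra.
  lra.
rewrite expRB ec invf_div.
have := @expR_le_pade R 1 ler01 => e3.
have : expR 1 * (alpha / 8) <= 3 * (alpha / 8) by rewrite ler_wpM2r//; lra.
lra.
Qed.

(** delta is at least 8 times the mean of phat; parameter 1 and exp 1 <= 3 give an exponent of at
    most - (3/4) m delta <= - L. *)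
Lemma stop_concentrated delta K : 0 < delta -> p K <= delta / 8 ->
  (Pr [set w | (3 * log_threshold alpha K <= (N w K)%:R * delta /\
     delta <= ph w K)%R] <= (3 / 8 * alpha)%:E)%E.
Proof.
have /andP[a0 a1] := alpha01; move=> d0 pK.
have L1 := log_threshold_gt1 alpha01 K.
have := @truncated_tail _ _ _ _ Pr P i eps alpha X eps01 alpha01 X_P X_indep K 1
  [set m | 3 * log_threshold alpha K <= m%:R * delta] (fun m => m%:R * delta)
  (3 / 8 * alpha).
rewrite (_ : [set w | _ /\ _] = [set w | (3 * log_threshold alpha K <= (N w K)%:R * delta /\
     delta <= ph w K)%R]); last first.
  apply: eq_set => w; congr (_ /\ (_ : bool)); rewrite !mul1r ler_pM2l// ltr0n.
  exact: sample_size_gt0.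
apply; first by rewrite mulr_ge0//; lra.
move=> m /= mL.
apply: (@le_trans _ _ (expR (- log_threshold alpha K))).
  rewrite ler_expR mul1r -/(p K).
  have e3 := @expR_le_pade R 1 ler01.
  have m0 : 0 <= m%:R :> R by [].
  have p0 : 0 <= p K * m%:R by rewrite mulr_ge0// survival_ge0.
  have : (expR 1 - 1) * (p K * m%:R) <= 2 * (p K * m%:R) by rewrite ler_wpM2r//; lra.
  have := ler_wpM2r m0 pK; lra.
rewrite expR_log_threshold// ler_pdivrMr ?ltr0n ?theta_gt0//.
have : 2 <= (theta K)%:R :> R by rewrite ler_nat /theta expnS leq_pmulr// expn_gt0.
by move=> t2; have := ler_wpM2l (ltW a0) t2; lra.
Qed.

End Concentration.

(** * The stopping iteration *)

Lemma exists_theta {R : realType} (y : R) : 1 <= y ->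
  exists K, y <= (theta K)%:R <= 2 * y.
Proof.
move=> y1; have ex : exists k, y <= (theta k)%:R.
  exists (Num.trunc y); apply: ltW; apply: lt_le_trans (truncnS_gt y) _.
  by rewrite ler_nat /theta ltnW// ltn_expl.
have [K yK Kmin] := ex_minnP ex; exists K; rewrite yK/=.
case: K yK Kmin => [|k] yK Kmin; first by rewrite /theta expn1; lra.
rewrite /theta expnS natrM ler_pM2l// leNgt; apply/negP => yk.
by have := Kmin k (ltW yk); rewrite ltnn.
Qed.

Lemma ln_inv_ge {R : realType} (y c : R) : 0 < y -> y <= 1 - c -> c <= ln y^-1.
Proof.
move=> y0 yc; rewrite lnV ?posrE//.
have := @le_ln1Dx R (y - 1) ltac:(lra); rewrite (_ : 1 + (y - 1) = y); last by ring.
lra.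
Qed.

Lemma survival_le_eventually {R : realType} {n : nat} (P : 'M[R]_n) (i j : 'I_n)
    (h q : R) : stochastic P ->
  (forall k t, \sum_(s < t) survival P i s k <= h) -> 0 < q <= 1 ->
  exists s : nat, s%:R <= 3 * h * (2 * ln q^-1 + 1) /\
    forall t, (s <= t)%N -> survival P i t j <= q.
Proof.
move=> P_st Ph /andP[q0 q1].
have h1 : 1 <= h by have := Ph j 1%N; rewrite big_ord1 survival0.
have lq : 0 <= ln q^-1 by rewrite ln_ge0// invf_ge1.
(* Blocks of length 2 h halve the survival; 2 ln (1/q) of them suffice because ln 2 >= 1/2. *)
pose t0 := `|Num.ceil (2 * h)|%N; pose l := `|Num.ceil (2 * ln q^-1)|%N.
have t0h : 2 * h <= t0%:R by exact: le_natr_abs_ceil.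
have t0h' : t0%:R <= 3 * h.
  by have := @natr_abs_ceil_le R (2 * h) ltac:(lra); rewrite -/t0; lra.
have ll : 2 * ln q^-1 <= l%:R by exact: le_natr_abs_ceil.
have ll' : l%:R <= 2 * ln q^-1 + 1 by apply: natr_abs_ceil_le; lra.
exists (l * t0)%N; split; first by rewrite natrM mulrC; apply: ler_pM; lra.
move=> t lt; apply: le_trans (survival_homo i P_st j lt) _.
have t00 : (0 < t0)%N by rewrite -(ltr0n R); lra.
apply: le_trans (survival_geometric P_st l j (fun k => Ph k t0) t0h t00) _.
rewrite exprVn -[leRHS]invrK lef_pV2 ?posrE ?exprn_gt0 ?invr_gt0//.
rewrite -ler_ln ?posrE ?exprn_gt0 ?invr_gt0// lnXn// -[_ *+ l]mulr_natl.
have := ler_wpM2l (_ : 0 <= l%:R :> R) (@ln2_ge R) => /(_ (ler0n _ _)); lra.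
Qed.

(** Here 264 = 4 * 66 and 12804 = 194 * 66. The logarithm is at most c + u + v + a, and A a >= 1
    lets the factor a be pulled out of the whole sum. *)
Lemma threshold_log_le {R : realType} (A h l al th : R) :
  1 <= A -> 1 <= h -> 0 < l -> 0 < al -> 1 <= A * ln al^-1 -> 0 < th ->
  0 <= ln (4 * th / al) -> th <= 66 * (A * (A * l) * h) ->
  194 * th * ln (4 * th / al) <=
  12804 * A ^+ 3 * (ln (264 * A ^+ 2) + 1) * (h * (1 + ln (1 + h)))
    * ln al^-1 * (l * (1 + ln (1 + l))).
Proof.
move=> A1 h1 l0 al0; set a := ln al^-1 => Aa th0 L0 th66.
have [B BE] : exists B, B = 264 * A ^+ 2 by eexists.
rewrite -BE; pose u := ln (1 + l); pose v := ln (1 + h); pose c := ln B.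
have B1 : 1 <= B by have : 1 <= A ^+ 2 by [rewrite exprn_ege1]; lra.
have c0 : 0 <= c by rewrite ln_ge0.
have u0 : 0 <= u by exact/ln1D_ge0/ltW/l0.
have v0 : 0 <= v by apply: ln1D_ge0; lra.
have [l1 h2 A3] : [/\ 1 + l \is Num.pos, 1 + h \is Num.pos & B \is Num.pos].
  by rewrite !posrE; split; lra.
have a0 : 0 <= a by rewrite -(@pmulr_rge0 _ A); lra.
have LK : ln (4 * th / al) <= c + u + v + a.
  have lh0 : 0 <= l * h by rewrite mulr_ge0//; lra.
  rewrite ln_div ?posrE ?mulr_gt0// /a lnV ?posrE// lerD2r.
  have B0 : B * (1 + l) \is Num.pos by exact: rpredM.
  rewrite /c /u /v -(lnM A3 l1) -(lnM B0 h2) ler_ln ?posrE ?mulr_gt0//.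
  apply: (@le_trans _ _ (B * (l * h))); first by clear -th66 BE; rewrite BE; lra.
  rewrite -[leRHS]mulrA ler_wpM2l//; last by clear -l0 h1; lra.
  by rewrite ltW// -posrE.
have h3 : c + u + v + a <= a * A * ((c + 1) * (1 + u) * (1 + v)).
  apply: (@le_trans _ _ (a * A * (c + u + v + 1))).
    have : 0 <= (A * a - 1) * (c + u + v).
      by rewrite mulr_ge0 ?subr_ge0 ?addr_ge0.
    have : a <= A * a by rewrite ler_peMl.
    clear; lra.
  rewrite ler_wpM2l ?mulr_ge0//; first by clear -A1; lra.
  have := mulr_ge0 c0 u0; have := mulr_ge0 c0 v0; have := mulr_ge0 u0 v0.
  have := mulr_ge0 (mulr_ge0 c0 u0) v0; clear; lra.
have -> : 12804 * A ^+ 3 * (c + 1) * (h * (1 + v)) * a * (l * (1 + u)) =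
  194 * (66 * (A * (A * l) * h)) * (a * A * ((c + 1) * (1 + u) * (1 + v))) by ring.
apply: ler_pM; [|exact: L0| |exact: le_trans LK h3].
  by apply: mulr_ge0; [clear; lra|exact: ltW].
by apply: ler_wpM2l; [clear; lra|].
Qed.

Definition steps_constant {R : realType} (A : nat) : R :=
  12804 * A%:R ^+ 3 * (ln (264 * A%:R ^+ 2) + 1).

Lemma steps_constant_gt0 {R : realType} (A : nat) : (0 < A)%N ->
  0 < steps_constant A :> R.
Proof.
move=> A0; have A2 : 1 <= A%:R ^+ 2 :> R by rewrite exprn_ege1// ler1n.
apply: mulr_gt0; first by rewrite mulr_gt0 ?exprn_gt0 ?ltr0n.
by rewrite ltr_wpDl// ln_ge0//; lra.
Qed.

Section Steps.
Context {R : realType} {n : nat} {d} {Omega : measurableType d}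
  (Pr : probability Omega R).
Variables (P : 'M[R]_n) (i : 'I_n) (eps alpha delta h : R)
  (A : nat) (X : nat -> nat -> nat -> Omega -> 'I_n).
Hypotheses (P_st : stochastic P) (eps01 : 0 < eps < 1)
  (alpha01 : 0 < alpha < 1) (delta01 : 0 < delta < 1).
Hypothesis X_P : forall k s, markov_chain_from Pr P i (X k s).
Hypothesis X_indep : mutually_independent Pr
  (fun ks : nat * nat => sigma_process (X ks.1 ks.2)).
Hypothesis h_ge : forall j t, \sum_(s < t) survival P i s j <= h.
Hypotheses (A_gt0 : (0 < A)%N) (reg : regime A eps alpha delta).

Let x w k s t := X k s t w.
Let a := ln alpha^-1.
Let l := ln delta^-1.

Let A1 : 1 <= A%:R :> R. Proof. by rewrite ler1n. Qed.

Let Aa : 1 <= A%:R * a.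
Proof.
have /andP[a0 a1] := alpha01; case: reg => aA _ _.
have A0 : A%:R != 0 :> R by rewrite gt_eqF//; have := A1; lra.
by rewrite -[leLHS](mulfV A0) ler_wpM2l// ln_inv_ge.
Qed.

Let Al : 1 <= A%:R * l.
Proof.
have /andP[a0 a1] := delta01; case: reg => _ dA _.
have A0 : A%:R != 0 :> R by rewrite gt_eqF//; have := A1; lra.
by rewrite -[leLHS](mulfV A0) ler_wpM2l// ln_inv_ge.
Qed.

Let l0 : 0 < l.
Proof. by rewrite -(@pmulr_rgt0 _ A%:R) ?ltr0n//; have := Al; lra. Qed.

Let a0 : 0 < a.
Proof. by rewrite -(@pmulr_rgt0 _ A%:R) ?ltr0n//; have := Aa; lra. Qed.

Let h1 : 1 <= h.
Proof. by have := h_ge i 1; rewrite big_ord1 survival0. Qed.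

Let ln8 : ln (8 : R) <= 3.
Proof.
have -> : 8 = 2 ^+ 3 :> R by rewrite -natrX.
rewrite lnXn// -[_ *+ 3]mulr_natl; have := @le_ln1Dx R 1 ltac:(lra).
by rewrite (_ : 1 + 1 = 2)//; lra.
Qed.

(** 33 = 3 * 11: the decay time is 3 h (2 ln (1/q) + 1), and 2 (3 + (A + 1) l) + 1 <= 11 A l because
    A l >= 1. The further factor A makes the threshold at least A h. *)
Let Lam := 33 * (A%:R * (A%:R * l) * h).

Let ALam : A%:R * h <= Lam.
Proof.
have Ah : 0 <= A%:R * h by rewrite mulr_ge0//; have := h1; lra.
have : A%:R * h <= A%:R * l * (A%:R * h) by rewrite ler_peMl.
rewrite /Lam; lra.
Qed.

Let stop_time q : 0 < q <= 1 -> ln q^-1 <= 3 + (A%:R + 1) * l ->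
  exists K, [/\ (theta K)%:R <= 2 * Lam, A%:R * h <= (theta K)%:R &
    survival P i (theta K) i <= q].
Proof.
move=> q01 lq; have [s [sh sq]] := survival_le_eventually i P_st h_ge q01.
have Lam1 : 1 <= Lam.
  by apply: le_trans ALam; rewrite -[leLHS]mul1r; apply: ler_pM.
have [K /andP[LK K2]] := exists_theta Lam1.
exists K; split=> //; first exact: le_trans LK.
apply: sq; rewrite -(ler_nat R); apply: le_trans LK; apply: le_trans sh _.
apply: (@le_trans _ _ (3 * h * (11 * (A%:R * l)))).
  rewrite ler_wpM2l//; first by have := h1; lra.
  have : l <= A%:R * l by rewrite ler_peMl// ltW.
  have := Al; lra.
rewrite /Lam; have : A%:R * l * h <= A%:R * (A%:R * l * h).
  by rewrite ler_peMl// mulr_ge0//; have := Al; have := h1; lra.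
lra.
Qed.

Lemma steps_within (B : \bar R) :
  ((steps_constant A * (h * (1 + ln (1 + h)))
     * a * (l * (1 + ln (1 + l))) * eps ^- 2)%:E <= B)%E ->
  ((1 - alpha)%:E < Pr [set w | (total_steps i eps alpha (x w) delta <= B)%E])%E.
Proof.
have fa : 3 / 8 * alpha < alpha / 2 by have /andP[? _] := alpha01; lra.
move=> hB; have /andP[al0 al1] := alpha01; have /andP[d0 d1] := delta01.
have /andP[e0 e1] := eps01; have hh := h1; have AA := A1; have aa := a0; have ll := l0.
suff [K [F [K2 Fm Ff FK]]] : exists K (F : set Omega),
    [/\ (theta K)%:R <= 2 * Lam, measurable F,
      (Pr F <= (3 / 8 * alpha)%:E)%E &
      forall w, ~ F w ->
        large_sample eps alpha (fun k => \sum_(t < theta k) survival P i t i) K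
          (sample_size i eps alpha (x w) K) ->
        phat i eps alpha (x w) K < delta].
  apply: (steps_probability P_st eps01 alpha01 X_P X_indep Fm Ff fa FK).
  apply: le_trans hB; rewrite lee_fin ler_wpM2r ?invr_ge0 ?exprn_ge0 ?(ltW e0)//.
  apply: threshold_log_le => //; [|exact: le_trans ler01 (ltW (log_threshold_gt1 alpha01 K))|].
    by rewrite ltr0n theta_gt0.
  by rewrite (le_trans K2)// /Lam mulrA -natrM.
clear hB fa.
have lnq q : 0 < q -> ln (q / 8)^-1 = ln q^-1 + ln 8.
  by move=> q0; rewrite invf_div lnM ?posrE ?invr_gt0// addrC.
case: reg => _ _ [dA|eA].
  have aAl : a <= A%:R * l.
    rewrite /a /l !lnV ?posrE// mulrN lerN2 mulr_natl -lnXn// ler_ln ?posrE//.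
    exact: exprn_gt0.
  have [||K [K2 _ pK]] := @stop_time (alpha * delta / 8).
  - rewrite divr_gt0 ?mulr_gt0// ler_pdivrMr//.
    have := ler_wpM2l (ltW al0) (ltW d1); lra.
  - rewrite lnq ?mulr_gt0// invfM lnM ?posrE ?invr_gt0// -/a -/l; have := ln8; lra.
  exists K, [set w | delta <= phat i eps alpha (x w) K]; split=> //.
  - exact: (measurable_stage eps alpha X_P K (fun _ _ q => delta <= q)).
  - exact: (stop_rare P_st eps01 alpha01 X_P X_indep).
  - by move=> w /negP; rewrite -ltNge.
have [||K [K2 AK pK]] := @stop_time (delta / 8).
- by rewrite divr_gt0// ler_pdivrMr//; lra.
- rewrite lnq// -/l; have := ln8; have : 0 <= A%:R * l by rewrite mulr_ge0// ltW.
  lra.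
exists K, [set w |
  3 * log_threshold alpha K <= (sample_size i eps alpha (x w) K)%:R * delta /\
  delta <= phat i eps alpha (x w) K]; split=> //.
- exact: (measurable_stage eps alpha X_P K (fun m _ q =>
    3 * log_threshold alpha K <= m%:R * delta /\ delta <= q)).
- exact: (stop_concentrated P_st eps01 alpha01 X_P X_indep).
move=> w /not_andP nF; rewrite /large_sample; set m := (sample_size _ _ _ _ _)%:R => large.
have m0 : 0 <= m by exact: ler0n.
have L0 : 0 <= log_threshold alpha K by have := log_threshold_gt1 alpha01 K; lra.
case: nF => [[]|/negP]; last by rewrite -ltNge.
(* With mu <= h, eps^2 <= A delta and theta >= A h, the inequality m mu eps^2 >= 3 theta L becomes m
   delta >= 3 L. *)
have Ah : 0 < A%:R * h by rewrite mulr_gt0 ?ltr0n//; have := h1; lra.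
rewrite -(ler_pM2r Ah).
apply: (@le_trans _ _ (3 * (theta K)%:R * log_threshold alpha K)).
  by rewrite mulrAC ler_wpM2r// ler_wpM2l.
apply: (le_trans large); rewrite mulrAC.
apply: (@le_trans _ _ (m * (A%:R * delta) * h)); last by lra.
apply: ler_pM => //; first by rewrite mulr_ge0// exprn_ge0// ltW.
  by apply: sumr_ge0 => t _; rewrite survival_ge0.
by rewrite ler_wpM2l.
Qed.

End Steps.

Theorem theorem2 (R : realType) :
  forall A : nat, (0 < A)%N -> exists (C C' : R) (m m' : nat),
  forall (n : nat) (P : 'M[R]_n) (pi : 'rV[R]_n) (i : 'I_n)
    (eps alpha delta : R)
    (d : measure_display) (Omega : measurableType d)
    (Pr : probability Omega R) (X : nat -> nat -> nat -> Omega -> 'I_n)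
    (d' : measure_display) (Omega' : measurableType d')
    (Q : 'I_n -> probability Omega' R) (Y : nat -> Omega' -> 'I_n),
  stochastic P -> irreducible P -> stationary P pi ->
  0 < eps < 1 -> 0 < alpha < 1 -> 0 < delta < 1 ->
  (forall k s, markov_chain_from Pr P i (X k s)) ->
  mutually_independent Pr
    (fun ks : nat * nat => sigma_process (X ks.1 ks.2)) ->
  (forall j, markov_chain_from (Q j) P j Y) ->
  let x w := fun k s t => X k s t w in
  let err w k :=
    let ph := pihat i eps alpha (x w) k in `|(ph - pi 0 i) / ph| in
  let bound (z : R) := eps * (1 + 2 / 3 * z) + 2 * delta * z in
  let H := max_hitting_time Q Y i in
  ((1 - alpha)%:E < Pr [set w | forall k : nat,
     (phat i eps alpha (x w) k < delta)%R ->
     [/\ (err w k <= bound (Zmax (fundamental_series P pi) i))%R,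
         (err w k <= bound (Zmax (fundamental_inv P pi) i))%R &
         (bound (Zmax (fundamental_series P pi) i))%:E
           <= eps%:E
              + (4 * ln 2)%:E * tmix P pi * (delta + eps / 3)%:E]])%E
  /\
  (let B := (C%:E * softO m H * softO m (ln alpha^-1)%:E
               * softO m (ln delta^-1)%:E * softO m (eps ^- 2)%:E)%E in
     let B' := (C'%:E * softO m' (tmix P pi) * softO m' (ln alpha^-1)%:E
               * softO m' (ln delta^-1)%:E
               * softO m' (pi 0 i)^-1%:E * softO m' (eps ^- 2)%:E)%E in
     (regime A eps alpha delta ->
        (1 - alpha)%:E <
        Pr [set w | total_steps i eps alpha (x w) delta <= B])%E
     /\ (B <= B')%E).
Proof.
move=> A A_gt0.
have C0 := @steps_constant_gt0 R A A_gt0.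
have [c c0 cP] : exists2 c : R, 0 < c & forall h t y : R,
    0 <= h -> 0 <= t -> 0 <= y -> h <= 11 / 4 * t * y ->
    h * (1 + ln (1 + h)) <= c * (t * (1 + ln (1 + t))) * (y * (1 + ln (1 + y))).
  exists (11 / 4 * (1 + ln (1 + 11 / 4))) => [|h t y]; last exact: softO_scale.
  by have := @ln1D_ge0 R (11 / 4) ltac:(lra); lra.
(* One logarithmic factor per quantity suffices, and the constants depend on A alone. *)
exists (steps_constant A), (steps_constant A * c), 1%N, 1%N.
move=> n P pi i eps alpha delta d Omega Pr X d' Omega' Q Y P_st P_irr P_pi
  eps01 alpha01 delta01 X_P X_indep Y_P x err bound H.
have /andP[e0 e1] := eps01; have /andP[a0 a1] := alpha01; have /andP[d0 d1] := delta01.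
have pi0 := stationary_gt0 P_st P_irr P_pi i.
have poisson k := poisson_fundamental_series P_st P_irr P_pi k i.
have poisson' k := poisson_fundamental_inv P_st P_irr P_pi k i.
(* As a lower bound on [tmix], this includes [tmix = +oo]. *)
have Zt z : (forall T : nat, (0 < T)%N ->
    \big[Num.max/0]_(x < n) TV (row x (P ^+ T)) pi <= 4^-1 -> z <= 11 / 8 * T%:R) ->
  ((8 / 11 * z)%:E <= tmix P pi)%E.
  by move=> h; apply: tmix_ge => T T0 /(h T T0); lra.
split.
  apply: (estimate_probability P_st eps01 alpha01 X_P X_indep (delta := delta)).
    rewrite (_ : [set _ | _] = \bigcap_k [set w |
        phat i eps alpha (x w) k < delta ->
        [/\ err w k <= bound (Zmax (fundamental_series P pi) i),
         err w k <= bound (Zmax (fundamental_inv P pi) i) &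
         ((bound (Zmax (fundamental_series P pi) i))%:E
           <= eps%:E
              + (4 * ln 2)%:E * tmix P pi * (delta + eps / 3)%:E)%E]]); last first.
      by apply/seteqP; split=> w h k; [move=> _; exact: h|exact: (h k I)].
    apply: bigcapT_measurable => k.
    exact: (measurable_stage eps alpha X_P k (fun _ t q => q < delta ->
        [/\ `|(t^-1 - pi 0 i) / t^-1| <= bound (Zmax (fundamental_series P pi) i),
         `|(t^-1 - pi 0 i) / t^-1| <= bound (Zmax (fundamental_inv P pi) i) &
         ((bound (Zmax (fundamental_series P pi) i))%:E
           <= eps%:E
              + (4 * ln 2)%:E * tmix P pi * (delta + eps / 3)%:E)%E])).
  move=> w h k kd; have [kT kp] := h k kd; split.
  - exact: (error_bound P_st P_irr P_pi eps01 alpha01 poisson kT kp kd).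
  - exact: (error_bound P_st P_irr P_pi eps01 alpha01 poisson' kT kp kd).
  have := Zt _ (fun T T0 Tm => Zmax_series_le i P_st P_irr P_pi T0 Tm).
  set Z := Zmax _ i; have := tmix_ge1 P pi.
  have l2 := @ln2_ge R; have de : 0 < delta + eps / 3 by lra.
  case: (tmix P pi) => [t| |]//=.
    rewrite !lee_fin => t1 Zt'.
    have h1 : 2 * Z * (delta + eps / 3) <= 4 * ln 2 * t * (delta + eps / 3).
      rewrite ler_pM2r//; have := ler_wpM2r (le_trans ler01 t1) l2; lra.
    rewrite /bound; lra.
  move=> _ _; rewrite gt0_muley ?lte_fin ?mulr_gt0 ?ln_gt0 ?ltr1n//.
  by rewrite gt0_mulye ?lte_fin// addey// leey.
move=> B B'.
have [h [Hh h_ge h_le]] : exists h : R, [/\ H = h%:E,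
    forall j t, \sum_(s < t) survival P i s j <= h &
    forall b, (forall j t, \sum_(s < t) survival P i s j <= b) -> h <= b].
  (* Finiteness of H comes from Zmax, as the mixing time of a periodic chain is infinite. *)
  apply: (max_hitting_time_fin (c := (2 * Zmax (fundamental_series P pi) i + 1) / pi 0 i)) => //.
  move=> j t; apply: le_trans (sum_survival_le P_st P_irr P_pi poisson t j) _.
  rewrite ler_wpM2r ?invr_ge0 ?(ltW pi0)//.
  have Zm k : `|fundamental_series P pi k i| <= Zmax (fundamental_series P pi) i.
    exact: (le_bigmax _ (fun k => `|fundamental_series P pi k i|)).
  have := Zm i; have := Zm j; rewrite !ler_norml => /andP[? _] /andP[_ ?].
  have : (j == i)%:R <= 1 :> R by rewrite lern1 leq_b1.
  lra.
have h1 : 1 <= h by have := h_ge i 1%N; rewrite big_ord1 survival0.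
have h0 : 0 < h := lt_le_trans ltr01 h1.
have la0 : 0 < ln alpha^-1 by rewrite ln_gt0// invf_gt1.
have ld0 : 0 < ln delta^-1 by rewrite ln_gt0// invf_gt1.
have e20 : 0 < eps ^- 2 by rewrite invr_gt0 exprn_gt0.
have y0 : 0 < (pi 0 i)^-1 by rewrite invr_gt0.
pose sO (r : R) := r * (1 + ln (1 + r)).
have sOE r : 0 < r -> softO 1 r%:E = (sO r)%:E by move=> r0; rewrite softO_fin// ltW.
have sO_ge r : 0 < r -> r <= sO r.
  by move=> r0; rewrite ler_peMr ?(ltW r0)// lerDl ln1D_ge0// ltW.
have sO0 r : 0 < r -> 0 < sO r by move=> r0; exact: lt_le_trans (sO_ge r r0).
have BE : B = (steps_constant A * sO h * sO (ln alpha^-1) *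
    sO (ln delta^-1) * sO (eps ^- 2))%:E.
  by rewrite /B Hh !sOE.
split=> [reg|].
  apply: (steps_within P_st eps01 alpha01 delta01 X_P X_indep h_ge A_gt0 reg).
  rewrite BE lee_fin -/(sO h) -/(sO (ln delta^-1)).
  have Ch : 0 < steps_constant A * sO h by exact: mulr_gt0 C0 (sO0 _ h0).
  have Cha : 0 < steps_constant A * sO h * ln alpha^-1 by exact: mulr_gt0.
  apply: ler_pM; [exact/ltW/(mulr_gt0 Cha (sO0 _ ld0))|exact: ltW| |exact: sO_ge].
  apply: ler_wpM2r; first exact/ltW/sO0.
  by apply: ler_wpM2l; [exact: ltW|exact: sO_ge].
have : ((4 / 11 * (h * pi 0 i))%:E <= tmix P pi)%E.
  rewrite (_ : 4 / 11 * _ = 8 / 11 * (h * pi 0 i / 2)); last by field.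
  apply: Zt => T T0 Tm.
  have := h_le _ (hitting_sum_mixing i P_st P_irr P_pi T0 Tm).
  by rewrite ler_pdivlMr//; lra.
have := tmix_ge1 P pi; rewrite BE /B'.
case: (tmix P pi) => [t| |]//=.
  rewrite !lee_fin => t1 ht; have t0 : 0 < t by lra.
  rewrite !sOE// -!EFinM lee_fin.
  have hs : sO h <= c * sO t * sO (pi 0 i)^-1.
    apply: cP; [lra|exact: ltW|exact: ltW|].
    by rewrite ler_pdivlMr//; lra.
  have -> : steps_constant A * c * sO t * sO (ln alpha^-1) * sO (ln delta^-1) *
      sO (pi 0 i)^-1 * sO (eps ^- 2) =
    steps_constant A * (c * sO t * sO (pi 0 i)^-1) * sO (ln alpha^-1) *
      sO (ln delta^-1) * sO (eps ^- 2) by ring.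
  do 3! (apply: ler_wpM2r; first exact/ltW/sO0).
  by apply: ler_wpM2l; [exact: ltW|exact: hs].
(* Infinite mixing time: B' is infinite, its other factors being positive. *)
move=> _ _; rewrite (_ : softO 1 +oo = +oo%E); last first.
  by rewrite /softO /expe/= ?addey// mulyy.
rewrite gt0_muley ?lte_fin; last exact: mulr_gt0.
rewrite !sOE//.
by rewrite !gt0_mulye ?leey// lte_fin; exact: sO0.
Qed.
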